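(* Let $n$ be a positive integer and let $P$ be a complex polynomial of degree $n$ that does not vanish in $|z|\leq 1$. Then for all $\alpha,\gamma\in\mathbb{C}$ with $\Re(\alpha)\leq \frac{n}{2}$ and $\Re(\gamma)\leq \frac{n}{2}$, and every $0\leq p<\infty$, $$\left\|zP'(z)-\alpha P(z)\right\|_p \leq \left\|(n-\alpha)z+\alpha\right\|_p\, \frac{\left\|P(z)\right\|_p}{\left\|1+z\right\|_p}$$ and $$\left\|z^2P''(z)+(1-\alpha-\gamma)zP'(z)+\alpha\gamma P(z)\right\|_p\leq \left\|\big(n(n-\alpha-\gamma)+\alpha\gamma\big)z+\alpha\gamma\right\|_p\,\frac{\left\|P(z)\right\|_p}{\left\|1+z\right\|_p}.$$ The results are best possible, and equality holds in both inequalities for $P(z)=az^n+b$, $|a|=|b|\neq 0$.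
   Context: For a complex polynomial $f(z)$ and $0<p<\infty$, $\|f(z)\|_p:=\left(\frac{1}{2\pi}\int_0^{2\pi}|f(e^{i\theta})|^p\,d\theta\right)^{1/p}$. For $p=0$, $\|f(z)\|_0:=\exp\left(\frac{1}{2\pi}\int_0^{2\pi}\log|f(e^{i\theta})|\,d\theta\right)$ (the Mahler measure), which is read as $0$ when $f$ is the zero polynomial. *)

(* Defs.v *)
From HB Require Import structures.
From mathcomp Require Import all_boot all_order all_algebra.
From mathcomp Require Import all_classical all_reals all_analysis.
From mathcomp Require Import complex.
Set Implicit Arguments.
Unset Strict Implicit.
Unset Printing Implicit Defensive.
Import Order.TTheory GRing.Theory Num.Theory.
Import numFieldNormedType.Exports.
Local Open Scope classical_set_scope.
Local Open Scope ring_scope.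

Definition cmod (R : realType) (z : R[i]) : R := Normc.normc z.

Definition expi (R : realType) (t : R) : R[i] := Complex (cos t) (sin t).

Definition circle_mean (R : realType) (g : R -> R) : R :=
  (2 * pi)^-1 * \int[lebesgue_measure]_(t in `[0, 2 * pi]) g t.

(* The library sets [ln 0 = 0].  A nonzero polynomial has finitely many zeros
   on the circle, so this does not affect its logarithmic integral; the zero
   polynomial, of Mahler measure 0, is treated separately. *)
Definition mahler (R : realType) (f : {poly R[i]}) : R :=
  if f == 0 then 0
  else expR (circle_mean (fun t => ln (cmod f.[expi t]))).

(* Meaningful for [0 <= p] only. *)
Definition pnorm (R : realType) (p : R) (f : {poly R[i]}) : R :=
  if p == 0 then mahler f
  else circle_mean (fun t => cmod f.[expi t] `^ p) `^ p^-1.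

Definition op1 (R : realType) (alpha : R[i]) (P : {poly R[i]}) : {poly R[i]} :=
  'X * P^`() - alpha *: P.

Definition op2 (R : realType) (alpha gamma : R[i]) (P : {poly R[i]}) :
    {poly R[i]} :=
  'X^2 * P^`(2) + (1 - alpha - gamma) *: ('X * P^`()) + (alpha * gamma) *: P.

Definition lin1 (R : realType) (n : nat) (alpha : R[i]) : {poly R[i]} :=
  (n%:R - alpha) *: 'X + alpha%:P.

Definition lin2 (R : realType) (n : nat) (alpha gamma : R[i]) : {poly R[i]} :=
  (n%:R * (n%:R - alpha - gamma) + alpha * gamma) *: 'X + (alpha * gamma)%:P.

Definition nonvanishing_of_degree (R : realType) (n : nat) (P : {poly R[i]}) :
    Prop :=
  size P = n.+1 /\ forall z : R[i], cmod z <= 1 -> P.[z] != 0.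

(* The constant [c] cannot be lowered in [||T P||_p <= c ||P||_p].  It need not
   be attained in the class: the extremal polynomials [a z^n + b], [|a| = |b|],
   have zeros on the unit circle, hence lie outside it. *)
Definition not_improvable (R : realType) (n : nat) (p : R)
    (T : {poly R[i]} -> {poly R[i]}) (c : R) : Prop :=
  forall c' : R,
    (forall P, nonvanishing_of_degree n P ->
       pnorm p (T P) <= c' * pnorm p P) ->
    c <= c'.

(* Main.v *)
Require Import Defs.
From mathcomp Require Import all_boot all_order all_algebra.
From mathcomp Require Import all_classical all_reals all_analysis.
From mathcomp Require Import measurable_realfun complex.
From mathcomp Require Import ring lra.
Set Implicit Arguments.
Unset Strict Implicit.
Unset Printing Implicit Defensive.
Import Order.TTheory GRing.Theory Num.Theory.
Import numFieldNormedType.Exports.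
Local Open Scope ring_scope.

(** Both operators are polynomials in the Euler operator [z d/dz]: [euler q]
    multiplies the coefficient of [X^k] by [q(k)], and the operators of the
    theorem are [euler q] for [q = X - alpha] and
    [q = (X - alpha) (X - gamma)].

    Zeros.  If [P] has no zero in a disc centred at the origin and degree at
    most [n], then [z P'/P] takes there values of real part less than [n / 2],
    so [z P' - b P] has no zero there when [n / 2 <= Re b] ([euler_neq0]).
    Let [q'] have as roots the mirror images [n - conj a] of the roots [a] of
    [q] in the line [Re x = n / 2].  For [|e| <= 1] all roots of [q' + e q],
    unless it is zero, lie in [n / 2 <= Re x] ([root_mirror_combination]).
    Hence [A = euler q P] and [B = euler q' P] satisfy [|A| <= |B|] on the circle
    ([euler_le_mirror]), and [B + e A] is the image of [P] under an operator
    that creates no zeros in the disc.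

    Arestov's theorem.  An operator [euler h] that creates no zeros in the disc
    satisfies [||euler h f||_p <= |h(0)| ||f||_p].  For [p = 0] this follows
    from Jensen's formula after reflecting the zeros of [f] out of the disc
    ([arestov_log]).  For [p > 0] two averagings reduce it to [p = 0]:
    [ln (max |w| s)] is the mean of [ln |w + s e^{i u}|] over [u]
    ([arestov_logmax]), and [x^p] is a mixture of the functions
    [max (ln x + v, 0)] of [x] ([powR_layer_cake], [arestov]).

    Conclusion.  For [p > 0] integrate
    [|| B + e^{i u} A ||_p <= |q'(0) + e^{i u} q(0)| ||P||_p], raised to the
    power [p], over [u].  As [|A| <= |B|], the mean over [u] of
    [|B + e^{i u} A|^p] is at least [|A|^p] times that of [|1 + e^{i u}|^p], and
    [|q'(0)| = |q(n)|]; this is the inequality ([pmean_euler_le]).  For [p = 0],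
    [||A||_0 <= ||B||_0 = |B(0)| = |q(n)| |P(0)|] is enough
    ([mahler_euler_le]).

    Sharpness.  [euler q (a X^n + b) = a q(n) X^n + b q(0)], and the change of
    variable [t -> n t] gives equality for [|a| = |b|].  The polynomials
    [X^n + r], [r > 1], belong to the class and tend to the extremal [X^n + 1];
    their norms are compared with those of the limit by Arestov's theorem for
    [n = 1] ([pnorm_linear_contract]). *)

(** * The modulus of a complex number and the circle *)

Section Modulus.
Context {R : realType}.
Implicit Types (x y z : R[i]) (s t : R).

Lemma cmod_ge0 z : 0 <= cmod z.
Proof. by case: z => a b; exact: sqrtr_ge0. Qed.

Lemma cmod0 : cmod (0 : R[i]) = 0. Proof. exact: Normc.normc0. Qed.

Lemma cmod1 : cmod (1 : R[i]) = 1. Proof. exact: Normc.normc1. Qed.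

Lemma cmodM x y : cmod (x * y) = cmod x * cmod y.
Proof. exact: Normc.normcM. Qed.

Lemma cmodV x : cmod x^-1 = (cmod x)^-1.
Proof. exact: Normc.normcV. Qed.

Lemma cmodN x : cmod (- x) = cmod x.
Proof. exact: normcN. Qed.

Lemma cmodD x y : cmod (x + y) <= cmod x + cmod y.
Proof. exact: le_normcD. Qed.

Lemma cmod_eq0 z : (cmod z == 0) = (z == 0).
Proof.
by apply/eqP/eqP => [/Normc.eq0_normc|->] //; exact: cmod0.
Qed.

Lemma cmod_gt0 z : (0 < cmod z) = (z != 0).
Proof. by rewrite lt_def cmod_ge0 andbT cmod_eq0. Qed.

Lemma cmodX z k : cmod (z ^+ k) = cmod z ^+ k.
Proof. by elim: k => [|k IH]; rewrite ?expr0 ?cmod1// !exprS cmodM IH. Qed.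

Lemma cmod_sqr z : cmod z ^+ 2 = complex.Re z ^+ 2 + complex.Im z ^+ 2.
Proof. by case: z => a b /=; rewrite sqr_sqrtr // addr_ge0 ?sqr_ge0. Qed.

Lemma cmodE z : cmod z = Num.sqrt (complex.Re z ^+ 2 + complex.Im z ^+ 2).
Proof. by case: z. Qed.

Lemma cmod_real t : cmod (t%:C)%C = `|t|.
Proof. by rewrite cmodE /= expr0n addr0 sqrtr_sqr. Qed.

Lemma cmodC z : cmod (z^*)%C = cmod z.
Proof. by rewrite !cmodE; case: z => a b /=; rewrite sqrrN. Qed.

Lemma cmod_dist x y : cmod x - cmod y <= cmod (x - y).
Proof. by rewrite lerBlDr (le_trans _ (cmodD _ _))// subrK. Qed.

Lemma cmodB x y : cmod (x - y) = cmod (y - x).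
Proof. by rewrite -cmodN opprB. Qed.

Lemma le_cmod x y : (cmod x <= cmod y) = (cmod x ^+ 2 <= cmod y ^+ 2).
Proof. by rewrite ler_sqr// nnegrE cmod_ge0. Qed.

Lemma lt_cmod x y : (cmod x < cmod y) = (cmod x ^+ 2 < cmod y ^+ 2).
Proof. by rewrite ltr_sqr// nnegrE cmod_ge0. Qed.

Lemma cReD x y : complex.Re (x + y) = complex.Re x + complex.Re y.
Proof. by case: x; case: y. Qed.
Lemma cReN x : complex.Re (- x) = - complex.Re x.
Proof. by case: x. Qed.
Lemma cImD x y : complex.Im (x + y) = complex.Im x + complex.Im y.
Proof. by case: x; case: y. Qed.
Lemma cImN x : complex.Im (- x) = - complex.Im x.
Proof. by case: x. Qed.
Lemma cReM x y : complex.Re (x * y) =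
  complex.Re x * complex.Re y - complex.Im x * complex.Im y.
Proof. by case: x; case: y. Qed.
Lemma cImM x y : complex.Im (x * y) =
  complex.Re x * complex.Im y + complex.Im x * complex.Re y.
Proof. by case: x; case: y. Qed.
Lemma cRe_nat k : complex.Re (k%:R : R[i]) = k%:R.
Proof. by elim: k => // k IH; rewrite -!natr1 cReD IH. Qed.
Lemma cIm_nat k : complex.Im (k%:R : R[i]) = 0.
Proof. by elim: k => // k IH; rewrite -natr1 cImD IH addr0. Qed.
Lemma cReC x : complex.Re (x^*)%C = complex.Re x.
Proof. by case: x. Qed.
Lemma cImC x : complex.Im (x^*)%C = - complex.Im x.
Proof. by case: x. Qed.

Lemma complex_eq x y : complex.Re x = complex.Re y ->
  complex.Im x = complex.Im y -> x = y.
Proof. by case: x => a b; case: y => c d /= -> ->. Qed.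

Definition ReImE := (cReD, cReN, cImD, cImN, cReM, cImM, cRe_nat, cIm_nat, cReC, cImC).

Lemma cmod_expi t : cmod (expi t) = 1.
Proof. by rewrite cmodE /= cos2Dsin2 sqrtr1. Qed.

Lemma expi_neq0 t : expi t != 0.
Proof. by rewrite -cmod_eq0 cmod_expi oner_eq0. Qed.

Lemma expiD s t : expi (s + t) = expi s * expi t.
Proof.
apply: complex_eq; rewrite ?cReM ?cImM /=; first exact: cosD.
by rewrite sinD addrC.
Qed.

Lemma expi0 : expi (0 : R) = 1.
Proof. by rewrite /expi cos0 sin0. Qed.

Lemma expiN t : expi (- t) = (expi t)^*%C.
Proof. by rewrite /expi cosN sinN. Qed.

Lemma expi2pi : expi (2 * pi : R) = 1.
Proof. by rewrite /expi mulr_natl cos2pi sin2pi. Qed.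

Lemma expiMn t k : expi (k%:R * t) = expi t ^+ k.
Proof.
elim: k => [|k IH]; first by rewrite mul0r expi0.
by rewrite -natr1 mulrDl mul1r expiD IH exprSr.
Qed.

Lemma expi_periodic t : expi (t + 2 * pi) = expi t.
Proof. by rewrite expiD expi2pi mulr1. Qed.

Lemma expiC t : (expi t)^*%C = (expi t)^-1.
Proof.
apply: (mulIf (expi_neq0 t)); rewrite mulVf ?expi_neq0// -expiN -expiD.
by rewrite addNr expi0.
Qed.

Lemma unit_expi z : cmod z = 1 -> exists2 t, 0 <= t <= 2 * pi & z = expi t.
Proof.
case: z => a b z1.
have ab : a ^+ 2 + b ^+ 2 = 1 by rewrite -[LHS](cmod_sqr (Complex a b)) z1 expr1n.
have a1 : -1 <= a <= 1.
  rewrite -ler_norml -(@expr_le1 _ 2)//.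
  by rewrite -normrX ger0_norm ?sqr_ge0// -ab lerDl sqr_ge0.
have p0 := pi_ge0 R.
have /andP[c0 c1] : 0 <= acos a <= pi by rewrite acos_ge0 ?acos_lepi.
have s2 : sin (acos a) = `|b|.
  rewrite sin_acos// (_ : 1 - _ = b ^+ 2) ?sqrtr_sqr//.
  by rewrite -ab addrC addKr.
have [b0|b0] := leP 0 b.
- exists (acos a); first by apply/andP; split => //; nra.
  by rewrite /expi acosK ?in_itv// s2 ger0_norm.
- exists (2 * pi - acos a); first by apply/andP; split; nra.
  rewrite addrC expi_periodic expiN /expi acosK ?in_itv// s2 ltr0_norm//=.
  by rewrite opprK.
Qed.

Lemma polar z : exists2 t, 0 <= t <= 2 * pi & z = (cmod z)%:C%C * expi t.
Proof.
have [->|z0] := eqVneq z 0.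
  by exists 0; rewrite ?lexx ?cmod0 ?mul0r// mulr_ge0 ?pi_ge0.
have z1 : cmod (z / (cmod z)%:C%C) = 1.
  rewrite cmodM cmodV cmod_real ger0_norm ?cmod_ge0// divff//.
  by rewrite cmod_eq0.
have [t tI zt] := unit_expi z1; exists t => //.
rewrite -zt mulrCA divff ?mulr1// -cmod_eq0 cmod_real normr_eq0.
by rewrite cmod_eq0.
Qed.

End Modulus.

(** * Polynomials in the Euler operator and their zeros *)

Section EulerOperator.
Context {R : realType}.
Implicit Types (q f g : {poly R[i]}) (a c z : R[i]).

(** The operator [q(z d/dz)]: the monomials are its eigenvectors. *)
Definition euler q f : {poly R[i]} := \poly_(k < size f) (q.[k%:R] * f`_k).

Lemma coef_euler q f k : (euler q f)`_k = q.[k%:R] * f`_k.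
Proof.
by rewrite coef_poly; case: ltnP => // /(nth_default 0) ->; rewrite mulr0.
Qed.

Lemma size_euler q f : (size (euler q f) <= size f)%N.
Proof. exact: size_poly. Qed.

Lemma eulerM q1 q2 f : euler (q1 * q2) f = euler q1 (euler q2 f).
Proof. by apply/polyP => k; rewrite !coef_euler hornerM mulrA. Qed.

Lemma eulerDl q1 q2 f : euler (q1 + q2) f = euler q1 f + euler q2 f.
Proof. by apply/polyP => k; rewrite coefD !coef_euler hornerD mulrDl. Qed.

Lemma eulerZl a q f : euler (a *: q) f = a *: euler q f.
Proof. by apply/polyP => k; rewrite coefZ !coef_euler hornerZ mulrA. Qed.

Lemma eulerDr q f g : euler q (f + g) = euler q f + euler q g.
Proof. by apply/polyP => k; rewrite coefD !coef_euler coefD mulrDr. Qed.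

Lemma eulerZr a q f : euler q (a *: f) = a *: euler q f.
Proof. by apply/polyP => k; rewrite coefZ !coef_euler coefZ mulrCA. Qed.

Lemma eulerC a f : euler a%:P f = a *: f.
Proof. by apply/polyP => k; rewrite coef_euler hornerC coefZ. Qed.

Lemma euler_const q c : euler q c%:P = (q.[0] * c)%:P.
Proof.
apply/polyP => -[|k]; rewrite coef_euler !coefC//=.
by rewrite mulr0.
Qed.

Lemma euler_Xn q n : euler q 'X^n = q.[n%:R] *: 'X^n.
Proof.
apply/polyP => k; rewrite coef_euler coefZ coefXn.
by case: eqVneq => [->|]; rewrite ?mulr0.
Qed.

Lemma euler_at0 q f : (euler q f).[0] = q.[0] * f.[0].
Proof. by rewrite [LHS]horner_coef0 coef_euler [f.[0]]horner_coef0. Qed.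

Lemma euler_XsubC a f : euler ('X - a%:P) f = 'X * f^`() - a *: f.
Proof.
apply/polyP => k; rewrite coef_euler hornerXsubC mulrBl coefB coefZ coefXM.
by case: k => [|k]; rewrite ?mul0r// coef_deriv mulr_natl.
Qed.

Lemma op1E a f : op1 a f = euler ('X - a%:P) f.
Proof. by rewrite euler_XsubC. Qed.

Lemma op2E a b f : op2 a b f = euler (('X - a%:P) * ('X - b%:P)) f.
Proof.
rewrite eulerM !euler_XsubC /op2 derivB derivM derivX derivZ.
rewrite derivnS derivn1 -!mul_polyC !polyCB polyC1 polyCM expr2.

ring.
Qed.

Lemma cmod_lt_Re_half (u : R[i]) :
  cmod u < cmod (u - 1) -> complex.Re u < 2^-1.
Proof.
by rewrite lt_cmod !cmod_sqr !ReImE /= => ?; lra.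
Qed.

(** Each factor [X - x] contributes [z / (z - x)] to [w = z G'(z) / G(z)]; this
    lies in the half-plane [Re u < 1/2] of the points nearer to [0] than to
    [1]. *)
Lemma logarithmic_derivative_Re (r : seq R[i]) z :
    (forall x, x \in r -> cmod z < cmod x) ->
  let G := \prod_(x <- r) ('X - x%:P) in
  exists w, [/\ z * G^`().[z] = w * G.[z],
    complex.Re w <= (size r)%:R / 2 &
    (0 < size r)%N -> complex.Re w < (size r)%:R / 2].
Proof.
elim: r => [_|x r IH zr] /=.
  by exists 0; rewrite big_nil derivC hornerC mulr0 mul0r/= mul0r.
have [y yr|w [wE wr _]] := IH; first by apply: zr; rewrite inE yr orbT.
have zx : cmod z < cmod x by apply: zr; rewrite mem_head.
have zx0 : z - x != 0 by apply: contraTneq zx => /subr0_eq->; rewrite ltxx.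
pose u := z / (z - x).
have u2 : complex.Re u < 2^-1.
  have [u0|u0] := eqVneq u 0; first by rewrite u0 /= invr_gt0.
  have uE : z = u * (z - x) by rewrite divfK.
  apply: cmod_lt_Re_half.
  (* As [u x = z (u - 1)] and [|z| < |x|], [|u| < |u - 1|]. *)
  have ux : cmod u * cmod x = cmod z * cmod (u - 1).
    by rewrite -!cmodM; congr cmod; rewrite mulrBr mulr1 {2}uE; ring.
  have z0 : 0 < cmod z.
    by rewrite cmod_gt0; apply: contraNneq u0; rewrite /u => ->; rewrite mul0r.
  by rewrite -(ltr_pM2l z0) -ux [ltLHS]mulrC ltr_pM2l ?cmod_gt0//.
have lt : complex.Re (u + w) < (size r).+1%:R / 2.
  by rewrite cReD -natr1 mulrDl mul1r addrC ler_ltD.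
exists (u + w); split; [|exact: ltW|by []].
rewrite big_cons derivM derivXsubC mul1r hornerD !hornerM hornerXsubC.
rewrite mulrDr [z * (_ * _)]mulrCA wE -{1}[z](divfK zx0) -/u.
by rewrite mulrDl addrC; ring.
Qed.

(** It suffices to treat one factor [X - b] of [q] at a time, and
    [z g' - b g = (w - b) g], where [w], the logarithmic derivative, has real
    part less than [n / 2 <= Re b].  The strict inequality uses [0 < n] when
    [g] is constant. *)
Lemma euler_neq0 n q g z : (0 < n)%N -> q != 0 ->
    (forall b, root q b -> n%:R / 2 <= complex.Re b) ->
    (size g <= n.+1)%N -> (forall y, cmod y <= cmod z -> g.[y] != 0) ->
  (euler q g).[z] != 0.
Proof.
move=> n0 q0 qr.
have [rs qE] := closed_field_poly_normal q.
have lq : lead_coef q != 0 by rewrite lead_coef_eq0.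
have {qr} : forall b, b \in rs -> n%:R / 2 <= complex.Re b.
  by move=> b brs; apply: qr; rewrite qE rootZ// root_prod_XsubC.
rewrite qE eulerZl hornerZ => qr sg g0; rewrite mulf_neq0//.
have : forall y, cmod y <= cmod z ->
    (euler (\prod_(x <- rs) ('X - x%:P)) g).[y] != 0.
  elim: rs {qE} qr g sg g0 => [|b rs IH] qr g sg g0 y yz.
    by rewrite big_nil -polyC1 eulerC scale1r; exact: g0.
  rewrite big_cons mulrC eulerM; apply: IH => //.
  - by move=> c crs; apply: qr; rewrite inE crs orbT.
  - by apply: leq_trans sg; exact: size_euler.
  move=> {y yz} y yz; rewrite euler_XsubC.
  have g00 : g != 0.
    by apply: contraTneq (g0 0 _) => [->|]; rewrite ?horner0 ?eqxx ?cmod0 ?cmod_ge0.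
  have [rg gE] := closed_field_poly_normal g.
  have lg : lead_coef g != 0 by rewrite lead_coef_eq0.
  have srg : (size rg <= n)%N.
    by move: sg; rewrite gE size_scale// size_prod_XsubC.
  have [|w [wE wr wr']] := @logarithmic_derivative_Re rg y.
    move=> x xr; rewrite ltNge; apply/negP => xy.
    have /negP := g0 x (le_trans xy yz); apply.
    by rewrite gE -rootE rootZ// root_prod_XsubC.
  have wb : complex.Re w < complex.Re b.
    apply: lt_le_trans (qr b (mem_head _ _)).
    have [r0|r0] := posnP (size rg); last first.
      by apply: (lt_le_trans (wr' r0)); rewrite ler_pM2r ?ler_nat.
    by apply: (le_lt_trans wr); rewrite ltr_pM2r ?ltr_nat// r0.
  have -> : ('X * g^`() - b *: g).[y] = (w - b) * g.[y].
    rewrite !hornerE mulrBl; congr (_ - _).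
    by rewrite gE derivZ !hornerZ mulrCA wE mulrCA.
  rewrite mulf_neq0 ?g0// subr_eq0; apply: contraTneq wb => ->.
  by rewrite ltxx.
by apply.
Qed.

End EulerOperator.

(** * Reflection in the line [Re x = n / 2] *)

Section Reflection.
Context {R : realType}.
Implicit Types (q f g h : {poly R[i]}) (a c e x y z : R[i]) (s : seq R[i]).

Definition mirror (n : nat) a : R[i] := n%:R - (a^*)%C.

Definition roots_at s : {poly R[i]} := \prod_(a <- s) ('X - a%:P).

Lemma sqr_dist_mirror n a x :
  cmod (x - mirror n a) ^+ 2 - cmod (x - a) ^+ 2 =
  (n%:R - 2 * complex.Re x) * (n%:R - 2 * complex.Re a).
Proof. by rewrite !cmod_sqr /mirror !ReImE; ring. Qed.

Lemma le_dist_mirror n a x :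
    complex.Re x <= n%:R / 2 -> complex.Re a <= n%:R / 2 ->
  cmod (x - a) <= cmod (x - mirror n a).
Proof.
move=> xn an; rewrite le_cmod -subr_ge0 sqr_dist_mirror.
by rewrite mulr_ge0//; lra.
Qed.

Lemma lt_dist_mirror n a x :
    complex.Re x < n%:R / 2 -> complex.Re a < n%:R / 2 ->
  cmod (x - a) < cmod (x - mirror n a).
Proof.
move=> xn an; rewrite lt_cmod -subr_gt0 sqr_dist_mirror.
by rewrite mulr_gt0//; lra.
Qed.

Lemma mirror_id n a : complex.Re a = n%:R / 2 -> mirror n a = a.
Proof.
by move=> an; apply: complex_eq; rewrite /mirror !ReImE ?an; lra.
Qed.

Lemma Re_mirror n a : complex.Re a <= n%:R / 2 ->
  n%:R / 2 <= complex.Re (mirror n a).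
Proof. by rewrite /mirror !ReImE => ?; lra. Qed.

Lemma roots_at_cons a s : roots_at (a :: s) = ('X - a%:P) * roots_at s.
Proof. by rewrite /roots_at big_cons. Qed.

Lemma roots_at_mirror_neq0 n s x :
    (forall a, a \in s -> complex.Re a <= n%:R / 2) ->
    complex.Re x < n%:R / 2 ->
  (roots_at [seq mirror n a | a <- s]).[x] != 0.
Proof.
move=> sn xn; rewrite -rootE root_prod_XsubC; apply/negP => /mapP[a /sn].
by move=> /Re_mirror + xE; rewrite -xE leNgt xn.
Qed.

(** On the open half-plane [Re x < n / 2] the points [a] are nearer than their
    mirror images, so the product of distances to the former is the smaller
    one, strictly unless all of them lie on the mirror. *)
Lemma roots_at_mirror n s : (forall a, a \in s -> complex.Re a <= n%:R / 2) ->
  roots_at [seq mirror n a | a <- s] = roots_at s \/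
  forall x, complex.Re x < n%:R / 2 ->
    cmod (roots_at s).[x] < cmod (roots_at [seq mirror n a | a <- s]).[x].
Proof.
elim: s => [_|a s IH sn] /=; first by left.
have an : complex.Re a <= n%:R / 2 by apply: sn; rewrite mem_head.
have sn' b : b \in s -> complex.Re b <= n%:R / 2.
  by move=> bs; apply: sn; rewrite inE bs orbT.
have lt0 x : complex.Re x < n%:R / 2 ->
    0 < cmod (roots_at [seq mirror n a | a <- s]).[x].
  by move=> xn; rewrite cmod_gt0 roots_at_mirror_neq0.
have ma x : complex.Re x < n%:R / 2 -> 0 < cmod (x - mirror n a).
  move=> xn; rewrite cmod_gt0 subr_eq0; apply: contraTneq xn => ->.
  by rewrite -leNgt Re_mirror.
rewrite !roots_at_cons; have [E|lt] := IH sn'.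
- have [/mirror_id ->|an'] := eqVneq (complex.Re a) (n%:R / 2).
    by left; rewrite E.
  right => x xn; rewrite !hornerM !hornerXsubC !cmodM E ltr_pM2r -?E ?lt0//.
  by rewrite lt_dist_mirror// lt_neqAle an'.
- right => x xn; rewrite !hornerM !hornerXsubC !cmodM.
  apply: (@le_lt_trans _ _ (cmod (x - mirror n a) * cmod (roots_at s).[x])).
    by rewrite ler_wpM2r ?cmod_ge0// le_dist_mirror// ltW.
  by rewrite ltr_pM2l ?ma// lt.
Qed.

(** For [|e| < 1] this is clear from [roots_at_mirror].  It extends to [|e| = 1]
    because that inequality is strict unless [q' = q], in which case
    [q' + e q] is a multiple of [q]. *)
Lemma root_mirror_combination n s e x :
    (forall a, a \in s -> complex.Re a <= n%:R / 2) -> cmod e <= 1 ->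
    let h := roots_at [seq mirror n a | a <- s] + e *: roots_at s in
    h != 0 -> root h x ->
  n%:R / 2 <= complex.Re x.
Proof.
move=> sn e1 h h0 hx; rewrite leNgt; apply/negP => xn.
have q0 := roots_at_mirror_neq0 sn xn.
have qx : (roots_at [seq mirror n a | a <- s]).[x] = - e * (roots_at s).[x].
  move: hx; rewrite rootE /h hornerD hornerZ addr_eq0 => /eqP ->.
  by rewrite mulNr.
have [E|/(_ _ xn)] := roots_at_mirror sn.
- have /eqP : (1 + e) * (roots_at s).[x] = 0.
    by rewrite mulrDl mul1r -{1}E qx mulNr addNr.
  rewrite mulf_eq0 -E (negbTE q0) orbF => /eqP e0.
  by move: h0; rewrite /h E -{1}[roots_at s]scale1r -scalerDl e0 scale0r eqxx.
- rewrite qx cmodM cmodN ltNge => /negP; apply.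
  by rewrite ler_piMl ?cmod_ge0.
Qed.

Lemma roots_at_neq0 s : roots_at s != 0.
Proof. by rewrite monic_neq0// monic_prod_XsubC. Qed.

Lemma mirror_combination_neq0 n s e : cmod e < 1 ->
  roots_at [seq mirror n a | a <- s] + e *: roots_at s != 0.
Proof.
move=> e1; apply/eqP => /(congr1 (fun p : {poly R[i]} => p`_(size s))).
rewrite coefD coefZ coef0.
have E (t : seq R[i]) : (roots_at t)`_(size t) = 1.
  have /monicP : roots_at t \is monic by exact: monic_prod_XsubC.
  by rewrite /lead_coef /roots_at size_prod_XsubC.
rewrite -{1}(size_map (mirror n)) !E mulr1 => /eqP; rewrite addr_eq0 => /eqP.
by move=> /(congr1 (@cmod R)); rewrite cmodN cmod1 => ee; rewrite -ee ltxx in e1.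
Qed.

(** If the first value were larger, cancelling it against the second one with a
    factor [e], [|e| < 1], would produce a zero of an operator all of whose
    roots lie in [n / 2 <= Re b], against [euler_neq0]. *)
Lemma euler_le_mirror n s f z : (0 < n)%N ->
    (forall a, a \in s -> complex.Re a <= n%:R / 2) ->
    (size f <= n.+1)%N -> (forall y, cmod y <= cmod z -> f.[y] != 0) ->
  cmod (euler (roots_at s) f).[z] <=
  cmod (euler (roots_at [seq mirror n a | a <- s]) f).[z].
Proof.
move=> n0 sn sf f0; rewrite leNgt; apply/negP.
set A := (euler (roots_at s) f).[z]; set B := (euler _ f).[z] => BA.
have A0 : A != 0 by rewrite -cmod_gt0 (le_lt_trans _ BA)// cmod_ge0.
have e1 : cmod (- (B / A)) < 1.
  by rewrite cmodN cmodM cmodV ltr_pdivrMr ?mul1r// cmod_gt0.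
have h0 := mirror_combination_neq0 n s e1.
have := @euler_neq0 _ n _ f z n0 h0
  (fun b => root_mirror_combination sn (ltW e1) h0) sf f0.
rewrite eulerDl eulerZl hornerD hornerZ -/A -/B mulNr divfK// subrr.
by rewrite eqxx.
Qed.

End Reflection.

(** * Polynomials without zeros in the unit disc *)

Section UnitDisc.
Context {R : realType}.
Implicit Types (f g h : {poly R[i]}) (a b c e x y z : R[i]).

Definition zero_free f := forall y, cmod y < 1 -> f.[y] != 0.

(** Admissibility in the sense of Arestov's theorem. *)
Definition admissible n h := forall g,
  (size g <= n.+1)%N -> zero_free g -> zero_free (euler h g).

Lemma horner_lipschitz f : exists K, forall y z, cmod y <= 1 -> cmod z <= 1 ->
  cmod (f.[y] - f.[z]) <= K * cmod (y - z).
Proof.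
suff [K [M H]] : exists K M, forall y z, cmod y <= 1 -> cmod z <= 1 ->
    cmod (f.[y] - f.[z]) <= K * cmod (y - z) /\ cmod f.[y] <= M.
  by exists K => y z y1 z1; have [] := H y z y1 z1.
elim/poly_ind: f => [|f c [K [M H]]].
  by exists 0, 0 => y z _ _; rewrite !horner0 subr0 cmod0 mul0r.
exists (K + M), (M + cmod c) => y z y1 z1; have [H1 H2] := H y z y1 z1.
have H0 := cmod_ge0 (y - z).
rewrite !hornerMXaddC; split; last first.
  rewrite (le_trans (cmodD _ _))// lerD2r cmodM.
  by rewrite (le_trans _ H2)// ler_piMr ?cmod_ge0.
have -> : f.[y] * y + c - (f.[z] * z + c) = (f.[y] - f.[z]) * z + f.[y] * (y - z).
  by ring.
rewrite (le_trans (cmodD _ _))// !cmodM mulrDl lerD//.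
  by rewrite (le_trans _ H1)// ler_piMr ?cmod_ge0.
by rewrite ler_wpM2r.
Qed.

(** Both sides are Lipschitz, and [z] is approached along its radius. *)
Lemma le_cmod_closure f g z :
    (forall y, cmod y < 1 -> cmod f.[y] <= cmod g.[y]) -> cmod z = 1 ->
  cmod f.[z] <= cmod g.[z].
Proof.
move=> fg z1; have [K fK] := horner_lipschitz f.
have [L gL] := horner_lipschitz g.
have K0 : 0 <= K.
  have := le_trans (cmod_ge0 _) (fK 1 0 _ _).
  by rewrite subr0 cmod1 cmod0 mulr1 lexx ler01; apply.
have L0 : 0 <= L.
  have := le_trans (cmod_ge0 _) (gL 1 0 _ _).
  by rewrite subr0 cmod1 cmod0 mulr1 lexx ler01; apply.
apply/ler_addgt0Pr => e e0.
pose t := Num.min 1 (e / (K + L + 1)).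
have t0 : 0 < t by rewrite lt_min ltr01 divr_gt0//; lra.
have t1 : t <= 1 by rewrite ge_min lexx.
have te : (K + L) * t <= e.
  have : t <= e / (K + L + 1) by rewrite ge_min lexx orbT.
  by rewrite ler_pdivlMr; nra.
pose y := (1 - t)%:C%C * z.
have y1 : cmod y = 1 - t by rewrite cmodM cmod_real z1 mulr1 ger0_norm// subr_ge0.
have yz : cmod (y - z) = t.
  have -> : y - z = - (t%:C%C * z) by rewrite /y rmorphB rmorph1; ring.
  by rewrite cmodN cmodM cmod_real z1 mulr1 gtr0_norm.
have y11 : cmod y < 1 by rewrite y1; lra.
have /le_trans := cmod_dist f.[z] f.[y]; rewrite [cmod (_ - f.[y])]cmodB.
move=> /(_ _ (fK y z (ltW y11) _)); rewrite z1 lexx => /(_ isT) h1.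
have /le_trans := cmod_dist g.[y] g.[z].
move=> /(_ _ (gL y z (ltW y11) _)); rewrite z1 lexx => /(_ isT) h2.
have := fg y y11; rewrite yz in h1 h2; nra.
Qed.

(** As [|e f| < |g|] in the disc when [|e| < 1], the operator keeps [g + e f]
    free of zeros there, and no such [e] can cancel the two images. *)
Lemma admissible_le n h f g z : admissible n h ->
    (size f <= n.+1)%N -> (size g <= n.+1)%N -> zero_free g ->
    (forall y, cmod y < 1 -> cmod f.[y] <= cmod g.[y]) -> cmod z = 1 ->
  cmod (euler h f).[z] <= cmod (euler h g).[z].
Proof.
move=> hn sf sg g0 fg; apply: le_cmod_closure => {}z z1.
rewrite leNgt; apply/negP; set A := (euler h f).[z]; set B := (euler h g).[z] => BA.
have A0 : A != 0 by rewrite -cmod_gt0 (le_lt_trans _ BA)// cmod_ge0.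
pose e := - (B / A).
have e1 : cmod e < 1.
  by rewrite cmodN cmodM cmodV ltr_pdivrMr ?mul1r// cmod_gt0.
have /hn : (size (g + e *: f)%R <= n.+1)%N.
  rewrite (leq_trans (size_polyD _ _))// geq_max sg.
  by rewrite (leq_trans (size_scale_leq _ _)).
have ge0 : zero_free (g + e *: f).
  move=> y y1; rewrite hornerD hornerZ addr_eq0; apply/eqP => gE.
  have := fg y y1; rewrite leNgt gE cmodN cmodM => /negP; apply.
  rewrite gtr_pMl// cmod_gt0; apply/eqP => fy.
  by have := g0 y y1; rewrite gE fy mulr0 oppr0 eqxx.
move=> /(_ ge0 z z1); rewrite eulerDr eulerZr hornerD hornerZ -/A -/B.
by rewrite mulNr divfK// subrr eqxx.
Qed.

(** For [|a| < 1], [1 - conj(a) X] has its zero at the reflection of [a] in the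
    unit circle and the same modulus as [X - a] on that circle; it is [1] for
    [a = 0], whose reflection is the point at infinity. *)
Definition reflect_factor a : {poly R[i]} :=
  if cmod a < 1 then 1 - (a^*)%C *: 'X else 'X - a%:P.

Lemma reflect_factorP a y :
  [/\ cmod y <= 1 -> cmod (y - a) <= cmod (reflect_factor a).[y],
      cmod y = 1 -> cmod (reflect_factor a).[y] = cmod (y - a) &
      cmod y < 1 -> (reflect_factor a).[y] != 0].
Proof.
rewrite /reflect_factor; case: ltP => a1; last first.
  rewrite hornerXsubC; split => // y1; rewrite subr_eq0.
  by apply: contraTneq y1 => ->; rewrite -leNgt.
rewrite hornerD hornerN hornerZ hornerX hornerC.
have E : cmod (1 - (a^*)%C * y) ^+ 2 - cmod (y - a) ^+ 2 =
    (1 - cmod a ^+ 2) * (1 - cmod y ^+ 2).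
  by rewrite !cmod_sqr !ReImE /=; ring.
have a2 : 0 < 1 - cmod a ^+ 2 by rewrite subr_gt0 expr_lt1// cmod_ge0.
split=> y1.
- rewrite le_cmod -subr_ge0 E mulr_ge0 ?(ltW a2)//.
  by rewrite subr_ge0 expr_le1// cmod_ge0.
- apply/eqP; rewrite -(@eqrXn2 _ 2)// ?cmod_ge0// -subr_eq0 E y1.
  by rewrite expr1n subrr mulr0.
- rewrite -cmod_gt0 -(@ltr_pXn2r _ 2)// ?nnegrE ?cmod_ge0// expr0n/=.
  have : 0 < (1 - cmod a ^+ 2) * (1 - cmod y ^+ 2).
    by rewrite mulr_gt0// subr_gt0 expr_lt1// cmod_ge0.
  by rewrite -E; have := sqr_ge0 (cmod (y - a)); lra.
Qed.

Lemma size_reflect_factor a : (size (reflect_factor a) <= 2)%N.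
Proof.
rewrite /reflect_factor; case: ifP => _; last by rewrite size_XsubC.
rewrite (leq_trans (size_polyD _ _))// size_poly1 geq_max /= size_polyN.
by rewrite (leq_trans (size_scale_leq _ _))// size_polyX.
Qed.

Lemma root_reflection f : f != 0 -> exists g, [/\ (size g <= size f)%N,
  zero_free g,
  forall y, cmod y < 1 -> cmod f.[y] <= cmod g.[y] &
  forall y, cmod y = 1 -> cmod g.[y] = cmod f.[y]].
Proof.
move=> f0; have lf : lead_coef f != 0 by rewrite lead_coef_eq0.
have [r fE] := closed_field_poly_normal f.
have [g [sg g0 fg gf]] : exists g, [/\ (size g <= (size r).+1)%N, zero_free g,
    forall y, cmod y < 1 -> cmod (\prod_(x <- r) ('X - x%:P)).[y] <= cmod g.[y] &
    forall y, cmod y = 1 -> cmod g.[y] = cmod (\prod_(x <- r) ('X - x%:P)).[y]].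
  elim: r {fE} => [|x r [g [sg g0 fg gf]]].
    exists 1; rewrite size_poly1 big_nil; split => // y _.
    by rewrite hornerC oner_neq0.
  exists (reflect_factor x * g); split.
  - rewrite (leq_trans (size_polyMleq _ _))//= -subn1 leq_subLR.
    by rewrite (leq_trans (leq_add (size_reflect_factor x) sg)).
  - move=> y y1; rewrite hornerM mulf_neq0 ?g0//.
    by have [_ _ ->] := reflect_factorP x y.
  - move=> y y1; rewrite big_cons !hornerM hornerXsubC !cmodM.
    rewrite ler_pM ?cmod_ge0 ?fg//.
    by have [+ _ _] := reflect_factorP x y; apply; exact: ltW.
  - move=> y y1; rewrite big_cons !hornerM hornerXsubC !cmodM gf//.
    by have [_ -> ] := reflect_factorP x y.
exists (lead_coef f *: g); split.
- by rewrite [in leqRHS]fE !size_scale// size_prod_XsubC.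
- by move=> y y1; rewrite hornerZ mulf_neq0// g0.
- move=> y y1; rewrite [in leLHS]fE !hornerZ !cmodM ler_wpM2l ?cmod_ge0//.
  exact: fg.
- by move=> y y1; rewrite [in RHS]fE !hornerZ !cmodM gf.
Qed.

Lemma zero_free_factorization f : zero_free f -> exists2 bs : seq R[i],
  (forall b, b \in bs -> cmod b <= 1) &
  f = f.[0] *: \prod_(b <- bs) (1 - b *: 'X).
Proof.
move=> f0; have f00 : f != 0.
  by apply: contraTneq (f0 0 _) => [->|]; rewrite ?horner0 ?eqxx ?cmod0.
have lf : lead_coef f != 0 by rewrite lead_coef_eq0.
have [r fE] := closed_field_poly_normal f.
have r1 x : x \in r -> 1 <= cmod x.
  move=> xr; rewrite leNgt; apply/negP => /f0 /negP; apply.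
  by rewrite -rootE fE rootZ// root_prod_XsubC.
have [c [bs bs1 rE]] : exists c, exists2 bs : seq R[i],
    (forall b, b \in bs -> cmod b <= 1) &
    \prod_(x <- r) ('X - x%:P) = c *: \prod_(b <- bs) (1 - b *: 'X).
  elim: r r1 {fE} => [_|x r IH r1].
    by exists 1, [::] => //; rewrite !big_nil scale1r.
  have [|c [bs bs1 rE]] := IH.
    by move=> y yr; apply: r1; rewrite inE yr orbT.
  have x1 : 1 <= cmod x by apply: r1; rewrite mem_head.
  have x0 : x != 0 by rewrite -cmod_gt0 (lt_le_trans _ x1).
  exists (- x * c), (x^-1 :: bs) => [b|].
    rewrite inE => /orP[/eqP->|/bs1//].
    by rewrite cmodV invf_le1// cmod_gt0.
  have -> : \prod_(y <- x :: r) ('X - y%:P) =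
      - x *: (1 - x^-1 *: 'X) * \prod_(y <- r) ('X - y%:P).
    rewrite big_cons; congr (_ * _).
    rewrite scalerBr scalerA mulNr divff// scaleN1r opprK addrC.
    by rewrite -mul_polyC mulr1 polyCN.
  by rewrite rE big_cons -scalerAr -!scalerAl scalerA mulrC.
exists bs => //; rewrite {1}fE rE scalerA; congr (_ *: _).
rewrite [in RHS]fE rE scalerA hornerZ horner_prod big1_seq ?mulr1// => b _.
by rewrite !hornerE ?mulr0 ?subr0.
Qed.

End UnitDisc.

(** * Changes of variable *)

Section AffineChange.
Local Open Scope classical_set_scope.
Context {R : realType}.
Notation mu := (@lebesgue_measure R).
Local Open Scope ereal_scope.

Lemma measurable_affine (k c : R) :
  measurable_fun [set: R] (fun x : R => k * x + c)%R.
Proof. by apply: measurable_funD => //; exact: measurable_funM. Qed.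

Lemma affine_preimage_itv (k c : R) (b1 b2 : bool) (x y : R) : (0 < k)%R ->
  (fun t : R => k * t + c)%R @^-1` [set` Interval (BSide b1 x) (BSide b2 y)] =
  [set` Interval (BSide b1 ((x - c) / k)%R) (BSide b2 ((y - c) / k)%R)].
Proof.
move=> k0; apply/seteqP; split => t /=; rewrite !in_itv /=.
  by case: b1; case: b2; rewrite /= ?ler_pdivrMr ?ltr_pdivrMr ?ler_pdivlMr
    ?ltr_pdivlMr// ?lerBlDr ?ltrBlDr ?lerBrDr ?ltrBrDr [(t * k)%R]mulrC.
by case: b1; case: b2; rewrite /= ?ler_pdivrMr ?ltr_pdivrMr ?ler_pdivlMr
    ?ltr_pdivlMr// ?lerBlDr ?ltrBlDr ?lerBrDr ?ltrBrDr [(t * k)%R]mulrC.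
Qed.

Lemma lebesgue_measure_affine (k c : R) (A : set R) :
    (0 < k)%R -> measurable A ->
  (k%:E * pushforward mu (fun x : R => k * x + c : measurableTypeR R)%R A)%E = mu A.
Proof.
move=> k0 mA.
pose nu := @measure_function_pushforward__canonical__measure_function_Measure
  _ _ (measurableTypeR R) (measurableTypeR R) R mu _ (measurable_affine k c).
have k0' : (0 <= k)%R by exact: ltW.
rewrite (@lebesgue_measure_unique R (mscale (NngNum k0') nu)) //.
move=> _ [[a b] _ <-].
rewrite [RHS](_ : _ = k%:E * mu ((fun x => k * x + c)%R @^-1` `]a, b]))%E//.
rewrite (affine_preimage_itv c false false a b k0) !lebesgue_measure_itv/=.
rewrite !lte_fin ltr_pM2r ?invr_gt0// ltrD2r.
case: ifPn => _; last by rewrite mule0.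
rewrite -!EFinB -EFinM; congr (_%:E).
rewrite -mulrBl mulrC divfK ?gt_eqF//.
by rewrite opprB addrA subrK.
Qed.

Lemma ge0_integral_affine (k c : R) (D : set R) (f : R -> \bar R) :
    (0 < k)%R -> measurable D -> measurable_fun [set: R] f ->
    (forall x, 0 <= f x) ->
  \int[mu]_(x in D) f x =
  k%:E * \int[mu]_(x in (fun x => k * x + c)%R @^-1` D) f (k * x + c)%R.
Proof.
move=> k0 mD mf f0; have k0' : (0 <= k)%R by exact: ltW.
pose nu := @measure_function_pushforward__canonical__measure_function_Measure
  _ _ (measurableTypeR R) (measurableTypeR R) R mu _ (measurable_affine k c).
transitivity (\int[mscale (NngNum k0') nu]_(x in D) f x).
  apply: eq_measure_integral => A mA _.
  exact/esym/lebesgue_measure_affine.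
have mfD : measurable_fun D f by exact: measurable_funTS.
rewrite ge0_integral_mscale//; congr (_ * _).
by rewrite ge0_integral_pushforward//; exact: measurable_affine.
Qed.

End AffineChange.

Section Periodic.
Local Open Scope classical_set_scope.
Context {R : realType}.
Notation mu := (@lebesgue_measure R).
Local Open Scope ereal_scope.
Variables (T : R) (f : R -> \bar R).
Hypotheses (T0 : (0 < T)%R) (mf : measurable_fun [set: R] f)
  (f0 : forall x, 0 <= f x) (fT : forall x, f (x + T)%R = f x).

Let G a b := \int[mu]_(x in `[a, b[) f x.

Let G_cat a b c : (a <= b)%R -> (b <= c)%R -> G a c = G a b + G b c.
Proof.
move=> ab bc; rewrite /G -ge0_integral_setU//=.
- by rewrite -itv_bndbnd_setU// bnd_simp.
- by rewrite -itv_bndbnd_setU ?bnd_simp//; exact: measurable_funTS.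
- rewrite disj_set2E; apply/eqP; rewrite -subset0 => x [] /=.
  by rewrite !in_itv/= => /andP[_ xb] /andP[]; rewrite leNgt xb.
Qed.

Let G_shift a b c : G (a + c)%R (b + c)%R = \int[mu]_(x in `[a, b[) f (x + c)%R.
Proof.
rewrite /G (@ge0_integral_affine _ 1 c)// mul1e affine_preimage_itv//.
rewrite !divr1 !addrK.
by apply: eq_integral => x _; rewrite mul1r.
Qed.

Let G_period a b : G (a + T)%R (b + T)%R = G a b.
Proof. by rewrite G_shift; apply: eq_integral => x _; rewrite fT. Qed.

Let itv_co a b (g : R -> \bar R) : measurable_fun [set: R] g ->
  \int[mu]_(x in `[a, b]) g x = \int[mu]_(x in `[a, b[) g x.
Proof.
by move=> mg; rewrite integral_itv_bndo_bndc//; exact: measurable_funTS.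
Qed.

Lemma ge0_integral_rotation c : (0 <= c <= T)%R ->
  \int[mu]_(x in `[0%R, T]) f (x + c)%R = \int[mu]_(x in `[0%R, T]) f x.
Proof.
move=> /andP[c0 cT]; rewrite !itv_co//; last first.
  apply: measurableT_comp => //.
  exact: measurable_funD.
rewrite -G_shift add0r (@G_cat _ T)// ?lerDl//.
have -> : G T (T + c)%R = G 0%R c by rewrite -(G_period 0%R c) add0r addrC.
by rewrite addeC -G_cat.
Qed.

Lemma ge0_integral_dilation n : (0 < n)%N ->
  \int[mu]_(x in `[0%R, T]) f (n%:R * x)%R = \int[mu]_(x in `[0%R, T]) f x.
Proof.
move=> n0; have n0' : (0 < n%:R :> R)%R by rewrite ltr0n.
have T0' := ltW T0.
rewrite !itv_co//; last first.
  by apply: measurableT_comp => //; exact: mulrl_measurable.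
have E1 : G 0%R (n%:R * T)%R = n%:R%:E * \int[mu]_(x in `[0%R, T[) f (n%:R * x)%R.
  rewrite /G (@ge0_integral_affine _ n%:R 0%R)// affine_preimage_itv// !subr0 mul0r.
  rewrite mulrC mulKf ?gt_eqF//; congr (_ * _).
  by apply: eq_integral => x _; rewrite addr0.
have E2 m : G 0%R (m%:R * T)%R = m%:R%:E * G 0%R T.
  elim: m => [|m IH]; first by rewrite mul0r mul0e /G set_itvco0 integral_set0.
  have mT : (0 <= m%:R * T)%R by exact: mulr_ge0.
  rewrite -natr1 mulrDl mul1r (@G_cat _ T) ?lerDr//.
  have -> : G T (m%:R * T + T)%R = G 0%R (m%:R * T)%R.
    by rewrite -{1}[T]add0r G_period.
  rewrite IH addeC.
  by rewrite EFinD ge0_muleDl ?lee_fin// mul1e addeC.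
have := E2 n; rewrite E1 => /(congr1 (fun x => (n%:R^-1)%:E * x)).
by rewrite !muleA -EFinM mulVf ?gt_eqF// !mul1e.
Qed.

End Periodic.

(** * Means over the circle *)

Section ComplexMeasurable.
Local Open Scope classical_set_scope.
Context {R : realType} {d : measure_display} {T : measurableType d}.
Implicit Types (g h : T -> R[i]).

Definition cmeasurable g :=
  measurable_fun [set: T] (fun t => complex.Re (g t)) /\
  measurable_fun [set: T] (fun t => complex.Im (g t)).

Lemma cmeasurable_cst (c : R[i]) : cmeasurable (fun=> c).
Proof. by split; exact: measurable_cst. Qed.

Lemma cmeasurableD g h :
  cmeasurable g -> cmeasurable h -> cmeasurable (fun t => g t + h t).
Proof.
move=> [g1 g2] [h1 h2]; split.
  by under eq_fun do rewrite cReD; exact: measurable_funD.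
by under eq_fun do rewrite cImD; exact: measurable_funD.
Qed.

Lemma cmeasurableM g h :
  cmeasurable g -> cmeasurable h -> cmeasurable (fun t => g t * h t).
Proof.
move=> [g1 g2] [h1 h2]; split.
  by under eq_fun do rewrite cReM; apply: measurable_funB;
    exact: measurable_funM.
by under eq_fun do rewrite cImM; apply: measurable_funD; exact: measurable_funM.
Qed.

Lemma cmeasurable_expi (u : T -> R) : measurable_fun [set: T] u ->
  cmeasurable (fun t => expi (u t)).
Proof.
move=> mu; split => /=.
  apply: (measurableT_comp _ mu); apply: continuous_measurable_fun.
  exact: continuous_cos.
apply: (measurableT_comp _ mu); apply: continuous_measurable_fun.
exact: continuous_sin.
Qed.

Lemma cmeasurable_horner (f : {poly R[i]}) g :
  cmeasurable g -> cmeasurable (fun t => f.[g t]).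
Proof.
move=> mg; elim/poly_ind: f => [|f c IH].
  by under eq_fun do rewrite horner0; exact: cmeasurable_cst.
under eq_fun do rewrite hornerMXaddC; apply: cmeasurableD.
  exact: cmeasurableM.
exact: cmeasurable_cst.
Qed.

Lemma measurable_cmod g : cmeasurable g ->
  measurable_fun [set: T] (fun t => cmod (g t)).
Proof.
move=> [g1 g2]; under eq_fun do rewrite cmodE.
apply: (@measurableT_comp _ _ _ _ _ _ (@Num.sqrt R)).
  by apply: continuous_measurable_fun; exact: sqrt_continuous.
by apply: measurable_funD; exact: measurable_funX.
Qed.

End ComplexMeasurable.

Section CircleMean.
Local Open Scope classical_set_scope.
Context {R : realType}.
Notation mu := (@lebesgue_measure R).
Implicit Types (g h : R -> R) (f : {poly R[i]}).

Definition circle : set R := `[0, 2 * pi].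

Lemma twopi_gt0 : 0 < 2 * pi :> R.
Proof. by rewrite mulr_gt0// pi_gt0. Qed.

Lemma measurable_circle : measurable (circle : set (measurableTypeR R)).
Proof. exact: measurable_itv. Qed.
Hint Resolve measurable_circle : core.

Lemma lebesgue_circle : mu circle = (2 * pi)%:E.
Proof. by rewrite lebesgue_measure_itv /= lte_fin twopi_gt0 sube0. Qed.

Definition circle_integrable g := mu.-integrable circle (EFin \o g).

Lemma circle_integrable_bounded g (M : R) : measurable_fun [set: R] g ->
  (forall t, `|g t| <= M) -> circle_integrable g.
Proof.
move=> mg gM; apply: measurable_bounded_integrable => //.
- by have := ltry (2 * pi : R); rewrite -lebesgue_circle.
- exact: measurable_funTS.
- by exists M; split; [exact: num_real|] => x Mx t _; exact: le_trans (gM t) (ltW Mx).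
Qed.

Lemma circle_integrable_cst (c : R) : circle_integrable (fun=> c).
Proof. by apply: (@circle_integrable_bounded _ `|c|) => //; exact: measurable_cst. Qed.

Lemma circle_integrableD g h : circle_integrable g -> circle_integrable h ->
  circle_integrable (fun t => g t + h t).
Proof.
move=> ig ih; rewrite /circle_integrable.
rewrite (_ : EFin \o _ = (EFin \o g) \+ (EFin \o h))%E//.
exact: integrableD.
Qed.

Lemma circle_integrableZ (c : R) g : circle_integrable g ->
  circle_integrable (fun t => c * g t).
Proof. by move=> ig; exact: (@integrableZl _ _ _ mu circle measurable_circle c (EFin \o g)). Qed.

Lemma circle_meanE g : circle_integrable g ->
  (\int[mu]_(t in circle) (g t)%:E = (2 * pi * circle_mean g)%:E)%E.
Proof.
move=> ig; rewrite /circle_mean mulrA divff ?gt_eqF ?twopi_gt0// mul1r fineK//.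
exact: integrable_fin_num.
Qed.

Lemma circle_mean_cst (c : R) : circle_mean (fun=> c) = c.
Proof.
rewrite /circle_mean Rintegral_cst//.
rewrite [X in fine X](_ : _ = (2 * pi)%:E); last exact: lebesgue_circle.
by rewrite /= mulrC mulfK// gt_eqF ?twopi_gt0.
Qed.

Lemma circle_meanD g h : circle_integrable g -> circle_integrable h ->
  circle_mean (fun t => g t + h t) = circle_mean g + circle_mean h.
Proof. by move=> ig ih; rewrite /circle_mean RintegralD// mulrDr. Qed.

Lemma circle_meanZ (c : R) g : circle_integrable g ->
  circle_mean (fun t => c * g t) = c * circle_mean g.
Proof. by move=> ig; rewrite /circle_mean RintegralZl// mulrCA. Qed.

Lemma eq_circle_mean g h : g =1 h -> circle_mean g = circle_mean h.
Proof. by move=> /funext ->. Qed.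

Lemma le_circle_mean g h : circle_integrable g -> circle_integrable h ->
  (forall t, g t <= h t) -> circle_mean g <= circle_mean h.
Proof.
move=> ig ih gh; rewrite /circle_mean ler_pM2l ?invr_gt0 ?twopi_gt0//.
by apply: le_Rintegral => // t _.
Qed.

Lemma circle_mean_ge0 g : (forall t, 0 <= g t) -> 0 <= circle_mean g.
Proof.
move=> g0; rewrite mulr_ge0 ?invr_ge0 ?(ltW twopi_gt0)//.
by apply: Rintegral_ge0.
Qed.

(** The positive and the negative part are transformed separately. *)
Lemma circle_mean_rotation g c : measurable_fun [set: R] g ->
    (forall t, g (t + 2 * pi) = g t) -> 0 <= c <= 2 * pi ->
  circle_mean (fun t => g (t + c)) = circle_mean g.
Proof.
move=> mg gT cT; congr (_ * fine _).
have mG : measurable_fun [set: R] (EFin \o g) by exact/measurable_EFinP.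
rewrite integralE [RHS]integralE; congr (_ - _)%E.
  transitivity (\int[mu]_(t in circle) (EFin \o g)^\+ (t + c)%R)%E.
  by apply: eq_integral => t _; rewrite !funeposE.
apply: (@ge0_integral_rotation R _ (EFin \o g)^\+%E) => //.
  - exact: measurable_funepos.
  - by move=> x; rewrite !funeposE/= gT.
transitivity (\int[mu]_(t in circle) (EFin \o g)^\- (t + c)%R)%E.
  by apply: eq_integral => t _; rewrite !funenegE.
apply: (@ge0_integral_rotation R _ (EFin \o g)^\-%E) => //.
- exact: measurable_funeneg.
- by move=> x; rewrite !funenegE/= gT.
Qed.

Lemma circle_mean_dilation g n : measurable_fun [set: R] g ->
    (forall t, g (t + 2 * pi) = g t) -> (0 < n)%N ->
  circle_mean (fun t => g (n%:R * t)) = circle_mean g.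
Proof.
move=> mg gT n0; congr (_ * fine _).
have mG : measurable_fun [set: R] (EFin \o g) by exact/measurable_EFinP.
rewrite integralE [RHS]integralE; congr (_ - _)%E.
  transitivity (\int[mu]_(t in circle) (EFin \o g)^\+ (n%:R * t)%R)%E.
  by apply: eq_integral => t _; rewrite !funeposE.
apply: (@ge0_integral_dilation R _ (EFin \o g)^\+%E) => //.
  - exact: twopi_gt0.
  - exact: measurable_funepos.
  - by move=> x; rewrite !funeposE/= gT.
transitivity (\int[mu]_(t in circle) (EFin \o g)^\- (n%:R * t)%R)%E.
  by apply: eq_integral => t _; rewrite !funenegE.
apply: (@ge0_integral_dilation R _ (EFin \o g)^\-%E) => //.
- exact: twopi_gt0.
- exact: measurable_funeneg.
- by move=> x; rewrite !funenegE/= gT.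
Qed.

(** The fibres of [expi] are finite, which makes the zeros of a polynomial on
    the circle negligible. *)
Lemma expi_fiber t (z : R[i]) : circle t -> expi t = z ->
  t \in [:: acos (complex.Re z); 2 * pi - acos (complex.Re z)].
Proof.
rewrite /circle/= in_itv/= !inE => /andP[t0 t2] <- /=.
have [tpi|/ltW tpi] := leP t pi.
  by rewrite cosK ?in_itv/= ?t0 ?tpi// eqxx.
have <- : cos (2 * pi - t) = cos t.
  by rewrite addrC mulr_natl cosD2pi cosN.
rewrite cosK; first by rewrite opprB addrCA subrr addr0 eqxx orbT.
by rewrite in_itv/=; apply/andP; split; lra.
Qed.

Lemma ae_circle_neq0 f : f != 0 ->
  {ae mu, forall t, circle t -> f.[expi t] != 0}.
Proof.
move=> f0; have [r fE] := closed_field_poly_normal f.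
have lf : lead_coef f != 0 by rewrite lead_coef_eq0.
pose s := flatten [seq [:: acos (complex.Re z); 2 * pi - acos (complex.Re z)]
  | z <- r].
have cs : countable [set` s] by apply: finite_set_countable; exact: finite_seq.
exists [set` s]; split.
- exact: countable_measurable.
- exact: countable_lebesgue_measure0.
- move=> t /= /not_implyP[ct /negP]; rewrite negbK => ft.
  apply/flattenP; exists [:: acos (complex.Re (expi t));
    2 * pi - acos (complex.Re (expi t))]; last exact: expi_fiber.
  apply/mapP; exists (expi t) => //.
  by rewrite -root_prod_XsubC -(rootZ _ _ lf) -fE rootE.
Qed.

Lemma ae_circle_integral f g h : f != 0 -> measurable_fun [set: R] g ->
    measurable_fun [set: R] h -> (forall t, f.[expi t] != 0 -> g t = h t) ->
  (\int[mu]_(t in circle) (g t)%:E = \int[mu]_(t in circle) (h t)%:E)%E.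
Proof.
move=> f0 mg mh gh; apply: ae_eq_integral => //.
- by apply/measurable_EFinP; exact: measurable_funTS.
- by apply/measurable_EFinP; exact: measurable_funTS.
- have [N [mN N0 sN]] := ae_circle_neq0 f0; exists N; split => // t /= ht.
  by apply: sN => /= fc; apply: ht => ct; rewrite gh// fc.
Qed.

Lemma ae_circle_mean f g h : f != 0 -> measurable_fun [set: R] g ->
    measurable_fun [set: R] h -> (forall t, f.[expi t] != 0 -> g t = h t) ->
  circle_mean g = circle_mean h.
Proof.
by move=> f0 mg mh gh; congr (_ * fine _); exact: ae_circle_integral gh.
Qed.

Lemma ae_circle_integrable f g h : f != 0 -> measurable_fun [set: R] g ->
    measurable_fun [set: R] h -> (forall t, f.[expi t] != 0 -> g t = h t) ->
  circle_integrable g -> circle_integrable h.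
Proof.
move=> f0 mg mh gh /integrableP[_ ig]; apply/integrableP; split.
  by apply/measurable_EFinP; exact: measurable_funTS.
rewrite -(@ae_circle_integral f (fun t => `|g t|) (fun t => `|h t|))//.
- exact: measurableT_comp.
- exact: measurableT_comp.
- by move=> t ft; rewrite gh.
Qed.

(** Replacing [h] by [max (g, h)], which differs from it on a negligible set
    only, makes the inequality hold everywhere. *)
Lemma ae_le_circle_mean f g h : f != 0 -> measurable_fun [set: R] g ->
    measurable_fun [set: R] h -> circle_integrable g -> circle_integrable h ->
    (forall t, f.[expi t] != 0 -> g t <= h t) ->
  circle_mean g <= circle_mean h.
Proof.
move=> f0 mg mh ig ih gh.
have mm : measurable_fun [set: R] (fun t => Num.max (g t) (h t)).
  exact: measurable_maxr.
have E t : f.[expi t] != 0 -> h t = Num.max (g t) (h t).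
  by move=> /gh /max_idPr ->.
rewrite [leRHS](ae_circle_mean f0 mh mm)//; apply: le_circle_mean => //.
- exact: (ae_circle_integrable f0 mh mm).
- by move=> t; rewrite le_max lexx.
Qed.

End CircleMean.
#[export] Hint Resolve measurable_circle : core.

(** * Jensen's formula *)

Section Jensen.
Local Open Scope classical_set_scope.
Context {R : realType}.
Notation mu := (@lebesgue_measure R).
Implicit Types (f g : {poly R[i]}) (b c z : R[i]).

Definition logabs f (t : R) : R := ln (cmod f.[expi t]).

Lemma measurable_cmod_horner_expi f :
  measurable_fun [set: R] (fun t => cmod f.[expi t]).
Proof.
apply: measurable_cmod; apply: cmeasurable_horner; apply: cmeasurable_expi.
exact: measurable_id.
Qed.

Lemma measurable_logabs f : measurable_fun [set: R] (logabs f).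
Proof.
apply: (@measurableT_comp _ _ _ _ _ _ (@ln R)).
  exact: measurable_ln.
exact: measurable_cmod_horner_expi.
Qed.
Hint Resolve measurable_logabs : core.

Lemma logabs_periodic f t : logabs f (t + 2 * pi) = logabs f t.
Proof. by rewrite /logabs expi_periodic. Qed.

Let factor b : {poly R[i]} := 1 - b *: 'X.

Let factorE b z : (factor b).[z] = 1 - b * z.
Proof. by rewrite /factor !hornerE. Qed.

Let factor_neq0 b : factor b != 0.
Proof.
apply/eqP => /(congr1 (fun p : {poly R[i]} => p.[0])).
by rewrite factorE mulr0 subr0 horner0 => /eqP; rewrite oner_eq0.
Qed.

Let cmod_factor_le2 b t : cmod b <= 1 -> cmod (factor b).[expi t] <= 2.
Proof.
move=> b1; rewrite factorE (le_trans (cmodD _ _))// cmod1 cmodN cmodM.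
by rewrite cmod_expi mulr1; lra.
Qed.

Let cmod_factor_ge b t : 1 - cmod b <= cmod (factor b).[expi t].
Proof.
rewrite factorE -[X in X - _]cmod1.
by rewrite -[X in _ - X]mulr1 -(cmod_expi t) -cmodM cmod_dist.
Qed.

Let logabs_factor_le b r t : cmod b <= r -> r < 1 ->
  `|logabs (factor b) t| <= ln 2 - ln (1 - r).
Proof.
move=> br r1; have b1 : cmod b <= 1 by lra.
have ge := cmod_factor_ge b t; have le := cmod_factor_le2 t b1.
have r0 : 0 <= r by rewrite (le_trans _ br)// cmod_ge0.
have ln2 : 0 <= ln (2 : R) by rewrite ln_ge0//; lra.
have lnr : ln (1 - r) <= 0 by rewrite ln_le0//; lra.
have l1 : ln (1 - r) <= logabs (factor b) t by rewrite ler_ln ?posrE; lra.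
have l2 : logabs (factor b) t <= ln 2 by rewrite ler_ln ?posrE; lra.
by rewrite ler_norml; apply/andP; split; lra.
Qed.

Let integrable_factor_lt1 b : cmod b < 1 ->
  circle_integrable (logabs (factor b)).
Proof.
move=> b1; apply: (@circle_integrable_bounded _ _ (ln 2 - ln (1 - cmod b))) => //.
by move=> t; exact: logabs_factor_le.
Qed.

Let J b := circle_mean (logabs (factor b)).

Let J_rotation b c : cmod c = 1 -> J (b * c) = J b.
Proof.
move=> /unit_expi[t tI ->]; rewrite /J.
rewrite -(circle_mean_rotation (measurable_logabs (factor b)) _ tI).
  apply: eq_circle_mean => s.
  by rewrite /logabs !factorE expiD mulrAC mulrA.
exact: logabs_periodic.
Qed.

Let logabs_factorM b t : (factor b * factor (- b)).[expi t] != 0 ->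
  logabs (factor b) t + logabs (factor (- b)) t =
  logabs (factor (b ^+ 2)) (2%:R * t).
Proof.
rewrite hornerM mulf_eq0 negb_or => /andP[n1 n2].
rewrite /logabs -lnM ?posrE ?cmod_gt0// -cmodM !factorE expiMn.
by congr (ln (cmod _)); ring.
Qed.

(** [1 - b^2 w^2] factors as [(1 - b w) (1 + b w)]; the angle is doubled on the
    left, and the two factors on the right have the same mean since they differ
    by a rotation. *)
Let J_sqr b : circle_integrable (logabs (factor b)) ->
  circle_integrable (logabs (factor (- b))) -> J (b ^+ 2) = 2 * J b.
Proof.
move=> i1 i2.
have -> : 2 * J b = J b + J (- b).
  by rewrite -mulrN1 J_rotation ?cmodN ?cmod1//; ring.
rewrite /J -circle_meanD//.
rewrite -(@circle_mean_dilation _ (logabs (factor (b ^+ 2))) 2)//; last first.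
  exact: logabs_periodic.
apply/esym/(@ae_circle_mean _ (factor b * factor (- b))).
- by rewrite mulf_neq0.
- exact: measurable_funD.
- apply: measurableT_comp => //; exact: mulrl_measurable.
- by move=> t; exact: logabs_factorM.
Qed.

(** Iterating the doubling, [2^k |J b| = |J (b^(2^k))|] stays bounded. *)
Let J_lt1 b : cmod b < 1 -> J b = 0.
Proof.
move=> b1; set K := ln 2 - ln (1 - cmod b).
have JK c : cmod c <= cmod b -> `|J c| <= K.
  move=> cb; have cK t := logabs_factor_le t cb b1.
  have ic := integrable_factor_lt1 (le_lt_trans cb b1).
  rewrite ler_norml; apply/andP; split.
    rewrite -[leLHS]circle_mean_cst; apply: le_circle_mean => //.
      exact: circle_integrable_cst.
    by move=> t; have := cK t; rewrite ler_norml => /andP[].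
  rewrite -[leRHS]circle_mean_cst; apply: le_circle_mean => //.
    exact: circle_integrable_cst.
  by move=> t; have := cK t; rewrite ler_norml => /andP[].
have bX k : (0 < k)%N -> cmod (b ^+ k) <= cmod b.
  by case: k => // k _; rewrite cmodX exprS ler_piMr ?cmod_ge0// exprn_ile1// ?cmod_ge0// ltW.
have JX k : J (b ^+ (2 ^ k)) = 2 ^+ k * J b.
  elim: k => [|k IH]; first by rewrite expr0 mul1r.
  have b2 : cmod (b ^+ (2 ^ k)) < 1 by rewrite (le_lt_trans (bX _ _))// expn_gt0.
  rewrite expnSr exprM J_sqr ?IH ?exprS ?mulrA//; apply: integrable_factor_lt1 => //.
  by rewrite cmodN.
apply/eqP; rewrite -normr_eq0; apply/negP => /negP J0.
have {J0} J0 : 0 < `|J b| by rewrite lt_def J0 normr_ge0.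
have K0 : 0 <= K / `|J b| by rewrite divr_ge0// (le_trans _ (JK b _)).
have := archi_boundP K0; set k := Num.bound _ => kK.
have := JK (b ^+ (2 ^ k)); rewrite bX ?expn_gt0// JX => /(_ isT).
rewrite normrM normrX ger0_norm// leNgt => /negP; apply.
move: kK; rewrite ltr_pdivrMr// => /lt_le_trans; apply.
by rewrite ler_pM2r// -natrX ler_nat ltnW// ltn_expl.
Qed.

(** On the critical circle [|b| = 1] the logarithm is unbounded, and its
    integrability comes from monotone convergence: [ln (|1 - b w| + h)]
    decreases to [ln |1 - b w|] with [h], and its mean is at least the mean of
    [ln |1 - (1 - h) b w|], which vanishes. *)
Let integrable_factor b : cmod b <= 1 -> circle_integrable (logabs (factor b)).
Proof.
rewrite le_eqVlt => /predU1P[b1|/integrable_factor_lt1//].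
pose x (t : R) := cmod (factor b).[expi t].
have x0 t : 0 <= x t by exact: cmod_ge0.
have x2 t : x t <= 2 by apply: cmod_factor_le2; rewrite b1.
pose h k : R := harmonic k.
have h0 k : 0 < h k by exact: harmonic_gt0.
have h1 k : h k <= 1 by rewrite /h /= invf_le1// ler1n.
pose l k t := ln 3 - ln (x t + h k).
have ml k : measurable_fun [set: R] (l k).
  apply: measurable_funB => //; apply: (@measurableT_comp _ _ _ _ _ _ (@ln R)).
    exact: measurable_ln.
  apply: measurable_funD => //; exact: measurable_cmod_horner_expi.
have l0 k t : 0 <= l k t.
  rewrite subr_ge0 ler_ln ?posrE// ?ltr_wpDl//.
  by have := x2 t; have := h1 k; lra.
have nd t : {homo l ^~ t : k k' / (k <= k')%N >-> k <= k'}.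
  move=> k k' kk'; rewrite lerD2l lerN2 ler_ln ?posrE ?ltr_wpDl// lerD2l.
  by rewrite /h /= lef_pV2 ?posrE// ler_nat.
have lint k : (\int[mu]_(t in circle) (l k t)%:E <= (2 * pi * ln 3)%:E)%E.
  pose c := (1 - h k)%:C%C * b.
  have c1 : cmod c < 1.
    rewrite cmodM b1 mulr1 cmod_real ger0_norm ?subr_ge0//.
    by rewrite ltrBlDr ltrDl.
  have ic : circle_integrable (fun t => ln 3 + (-1) * logabs (factor c) t).
    apply: circle_integrableD; first exact: circle_integrable_cst.
    by apply: circle_integrableZ; exact: integrable_factor_lt1.
  have <- : circle_mean (fun t => ln 3 + (-1) * logabs (factor c) t) = ln 3.
    have jc := integrable_factor_lt1 c1.
    rewrite (circle_meanD (circle_integrable_cst _) (circle_integrableZ _ jc)).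
    by rewrite (circle_meanZ _ jc) [X in _ * X](J_lt1 c1) circle_mean_cst mulr0 addr0.
  rewrite -circle_meanE//; apply: ge0_le_integral => //.
  - by move=> t _; rewrite lee_fin; exact: l0.
  - by apply/measurable_EFinP; exact: measurable_funTS (ml _).
  - by apply/measurable_EFinP; case/integrableP: ic => /measurable_EFinP.
  move=> t _; rewrite lee_fin mulN1r lerD2l lerN2.
  have cx : cmod (factor c).[expi t] <= x t + h k.
    rewrite /x !factorE.
    have -> : 1 - c * expi t = 1 - b * expi t + (h k)%:C%C * (b * expi t).
      by rewrite /c rmorphB rmorph1; ring.
    rewrite (le_trans (cmodD _ _))// lerD2l !cmodM cmod_real b1 cmod_expi.
    by rewrite !mulr1 ger0_norm// ltW.
  rewrite ler_ln ?posrE// ?ltr_wpDl//.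
  by apply: lt_le_trans (cmod_factor_ge c t); rewrite subr_gt0.
have g0 t : 0 <= ln 3 - logabs (factor b) t.
  rewrite subr_ge0; have [xt|xt] := eqVneq (x t) 0.
    by rewrite /logabs -/(x t) xt ln0// ln_ge0//; lra.
  rewrite ler_ln ?posrE//; last by rewrite lt_def xt x0.
  by rewrite (le_trans (x2 t))//; lra.
have mg : measurable_fun [set: R] (fun t => ln 3 - logabs (factor b) t).
  by apply: measurable_funB => //; exact: measurable_logabs.
have gl t : ((ln 3 - logabs (factor b) t)%:E <= limn (fun k => (l k t)%:E))%E.
  have [xt|xt] := eqVneq (x t) 0.
    have -> : logabs (factor b) t = 0 by rewrite /logabs -/(x t) xt ln0.
    have cv := ereal_nondecreasing_cvgn
      (fun k k' kk' => (nd t k k' kk' : (l k t)%:E <= (l k' t)%:E)%E).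
    rewrite (cvg_lim _ cv)//; apply: ereal_sup_ge; exists (l 0%N t)%:E.
      by exists 0%N.
    by rewrite lee_fin /l xt add0r /h /= invr1 ln1.
  have xt0 : 0 < x t by rewrite lt_def xt x0.
  suff cv : (l k t)%:E @[k --> \oo] --> (ln 3 - ln (x t))%:E by rewrite (cvg_lim _ cv).
  apply: cvg_EFin; first exact: nearW.
  apply: cvgB; first exact: cvg_cst.
  have -> : ln (x t) = ln (x t + 0) by rewrite addr0.
  apply: (@cvg_comp _ _ _ (fun k => x t + h k) (@ln R) _ (nbhs (x t + 0))).
    by apply: cvgD; [exact: cvg_cst|exact: cvg_harmonic].
  by apply: continuous_ln; rewrite addr0.
have gint : (\int[mu]_(t in circle) (ln 3 - logabs (factor b) t)%:E < +oo)%E.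
  apply: (@le_lt_trans _ _ (2 * pi * ln 3)%:E); last exact: ltry.
  apply: (@le_trans _ _ (\int[mu]_(t in circle) limn (fun k => (l k t)%:E))%E).
    apply: ge0_le_integral => //.
    - by move=> t _; rewrite lee_fin; exact: g0.
    - by apply/measurable_EFinP; exact: measurable_funTS mg.
    - apply: (emeasurable_fun_cvg (fun k t => (l k t)%:E)).
        by move=> k; apply/measurable_EFinP; exact: measurable_funTS (ml _).
      move=> t _; apply: ereal_nondecreasing_is_cvgn => k k' kk'.
      by rewrite lee_fin; exact: nd.
  have -> : (\int[mu]_(t in circle) limn (fun k => (l k t)%:E) =
      limn (fun k => \int[mu]_(t in circle) (l k t)%:E))%E.
    apply: monotone_convergence => //.
    - by move=> k; apply/measurable_EFinP; exact: measurable_funTS (ml _).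
    - by move=> k t _; rewrite lee_fin; exact: l0.
    - by move=> t _ k k' kk'; rewrite lee_fin; exact: nd.
  apply: lime_le; last by apply: nearW => k; exact: lint.
  apply: ereal_nondecreasing_is_cvgn => k k' kk'.
  apply: ge0_le_integral => //.
  - by move=> t _; rewrite lee_fin; exact: l0.
  - by apply/measurable_EFinP; exact: measurable_funTS (ml _).
  - by apply/measurable_EFinP; exact: measurable_funTS (ml _).
  - by move=> t _; rewrite lee_fin; exact: nd.
have ig : circle_integrable (fun t => ln 3 - logabs (factor b) t).
  apply/integrableP; split.
    by apply/measurable_EFinP; exact: measurable_funTS mg.
  apply: le_lt_trans gint; apply: ge0_le_integral => //.
  - apply/measurable_EFinP; apply: measurable_funTS.
    exact: measurableT_comp mg.
  - by apply/measurable_EFinP; exact: measurable_funTS mg.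
  - by move=> t _; rewrite lee_fin ger0_norm// g0.
have -> : logabs (factor b) =
    (fun t => ln 3 + (-1) * (ln 3 - logabs (factor b) t)).
  by apply/funext => t; ring.
apply: circle_integrableD; first exact: circle_integrable_cst.
exact: circle_integrableZ.
Qed.

(** For [|b| = 1] a rotation reduces to [b = 1], a fixed point of squaring,
    where doubling reads [J 1 = 2 J 1]. *)
Let J_le1 b : cmod b <= 1 -> J b = 0.
Proof.
rewrite le_eqVlt => /predU1P[b1|/J_lt1//].
rewrite -[b]mul1r J_rotation//.
have : J (1 ^+ 2) = 2 * J 1.
  by apply: J_sqr; apply: integrable_factor; rewrite ?cmodN cmod1.
by rewrite expr1n; lra.
Qed.

(** Such an [f] is [f(0)] times a product of factors [1 - b X], [|b| <= 1],
    whose logarithmic means vanish. *)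
Lemma jensen f : zero_free f -> circle_integrable (logabs f) /\
  circle_mean (logabs f) = ln (cmod f.[0]).
Proof.
move=> f0; have [bs bs1 fE] := zero_free_factorization f0.
pose G s : {poly R[i]} := \prod_(b <- s) factor b.
have G0 s : G s != 0.
  elim: s => [|b s IH]; first by rewrite /G big_nil oner_neq0.
  by rewrite /G big_cons mulf_neq0.
have [iG mG] : circle_integrable (logabs (G bs)) /\
    circle_mean (logabs (G bs)) = 0.
  elim: bs bs1 {fE} => [_|b bs IH bs1].
    have -> : logabs (G [::]) = fun=> 0.
      by apply/funext => t; rewrite /logabs /G big_nil hornerC cmod1 ln1.
    by split; [exact: circle_integrable_cst|exact: circle_mean_cst].
  have [|iG mG] := IH; first by move=> c cs; apply: bs1; rewrite inE cs orbT.
  have ib : circle_integrable (logabs (factor b)).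
    by apply: integrable_factor; apply: bs1; rewrite mem_head.
  have Jb : J b = 0 by apply: J_le1; apply: bs1; rewrite mem_head.
  have E t : (G (b :: bs)).[expi t] != 0 ->
      logabs (factor b) t + logabs (G bs) t = logabs (G (b :: bs)) t.
    rewrite /logabs /G big_cons hornerM mulf_eq0 negb_or => /andP[n1 n2].
    by rewrite cmodM lnM ?posrE ?cmod_gt0.
  have mD : measurable_fun [set: R] (fun t => logabs (factor b) t + logabs (G bs) t).
    exact: measurable_funD.
  split; first by apply: (ae_circle_integrable (G0 (b :: bs)) mD _ E) => //;
    exact: circle_integrableD.
  rewrite -(ae_circle_mean (G0 (b :: bs)) mD _ E)// circle_meanD//.
  by rewrite mG addr0.
have f00 : f.[0] != 0 by apply: f0; rewrite cmod0.
have E t : (G bs).[expi t] != 0 -> ln (cmod f.[0]) + logabs (G bs) t = logabs f t.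
  move=> Gt; rewrite /logabs [in RHS]fE hornerZ cmodM lnM ?posrE ?cmod_gt0//.
have mD : measurable_fun [set: R] (fun t => ln (cmod f.[0]) + logabs (G bs) t).
  exact: measurable_funD.
have ic := @circle_integrable_cst R (ln (cmod f.[0])).
split; first by apply: (ae_circle_integrable (G0 bs) mD _ E) => //;
  exact: circle_integrableD.
rewrite -(ae_circle_mean (G0 bs) mD _ E)// circle_meanD//.
by rewrite mG addr0 circle_mean_cst.
Qed.

Lemma logabs_integrable f : f != 0 -> circle_integrable (logabs f).
Proof.
move=> /root_reflection[g [_ g0 _ gf]].
have -> : logabs f = logabs g.
  by apply/funext => t; rewrite /logabs gf// cmod_expi.
by have [] := jensen g0.
Qed.

Lemma le_circle_mean_logabs f g : f != 0 -> g != 0 ->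
    (forall z, cmod z = 1 -> cmod f.[z] <= cmod g.[z]) ->
  circle_mean (logabs f) <= circle_mean (logabs g).
Proof.
move=> f0 g0 fg; apply: (ae_le_circle_mean f0) => //; try exact: logabs_integrable.
move=> t ft; have le := fg _ (cmod_expi t).
by rewrite ler_ln ?posrE ?cmod_gt0// -cmod_gt0 (lt_le_trans _ le)// cmod_gt0.
Qed.

(** If [s <= |w|], [w + s X] has no zero in the open disc.  If [|w| < s], it has
    the same modulus on the circle as [s + conj(w) X], which has none. *)
Lemma jensen_linear (w : R[i]) (s : R) : 0 < s ->
  circle_integrable (fun t => ln (cmod (w + s%:C%C * expi t))) /\
  circle_mean (fun t => ln (cmod (w + s%:C%C * expi t))) =
  ln (Num.max (cmod w) s).
Proof.
move=> s0; have sC : cmod (s%:C%C) = s by rewrite cmod_real gtr0_norm.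
have [ws|ws] := leP s (cmod w).
  pose f : {poly R[i]} := w%:P + s%:C%C *: 'X.
  have fE z : f.[z] = w + s%:C%C * z by rewrite /f !hornerE.
  have f0 : zero_free f.
    move=> y y1; rewrite fE addr_eq0; apply/eqP => /(congr1 (@cmod R)).
    rewrite cmodN cmodM sC => wE; move: ws; rewrite wE leNgt => /negP; apply.
    by rewrite gtr_pMr.
  have [] := jensen f0; rewrite fE mulr0 addr0.
  rewrite (_ : logabs f = fun t => ln (cmod (w + s%:C%C * expi t)))//.
  by apply/funext => t; rewrite /logabs fE.
pose f : {poly R[i]} := s%:C%C%:P + (w^*)%C *: 'X.
have fE z : f.[z] = s%:C%C + (w^*)%C * z by rewrite /f !hornerE.
have f0 : zero_free f.
  move=> y y1; rewrite fE addr_eq0; apply/eqP => /(congr1 (@cmod R)).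
  rewrite sC cmodN cmodM cmodC => wE; move: ws; rewrite wE ltNge => /negP; apply.
  by rewrite ler_piMr ?cmod_ge0// ltW.
have [] := jensen f0; rewrite fE mulr0 addr0 sC.
rewrite (_ : logabs f = fun t => ln (cmod (w + s%:C%C * expi t)))//.
apply/funext => t; rewrite /logabs fE; congr ln.
rewrite -[RHS]cmodC -[RHS]mulr1 -(cmod_expi t) -cmodM; congr cmod.
have cs := cos2Dsin2 t; apply: complex_eq; rewrite !ReImE /=.
  by rewrite -[s in LHS]mulr1 -cs; ring.
by ring.
Qed.

End Jensen.
#[export] Hint Resolve measurable_logabs : core.

(** * Arestov's theorem *)

Section RestrictedTonelli.
Local Open Scope classical_set_scope.
Context {R : realType}.
Notation mu := (@lebesgue_measure R).
Local Open Scope ereal_scope.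
Variables (D1 D2 : set R) (f : R * R -> \bar R).
Hypotheses (mD1 : measurable (D1 : set (measurableTypeR R)))
  (mD2 : measurable (D2 : set (measurableTypeR R)))
  (mf : measurable_fun [set: R * R] f) (f0 : forall z, 0 <= f z).

Let g := f \_ (D1 `*` D2).

Let g0 z : 0 <= g z.
Proof. by rewrite /g patchE; case: ifP. Qed.

Let mg : measurable_fun [set: measurableTypeR R * measurableTypeR R] g.
Proof.
apply/(measurable_restrictT f); first exact: measurableX.
exact: measurable_funTS.
Qed.

Let gE1 x : \int[mu]_y g (x, y) = ((fun x => \int[mu]_(y in D2) f (x, y)) \_ D1) x.
Proof.
rewrite patchE; case: ifPn => xD.
  rewrite [RHS]integral_mkcond; apply: eq_integral => y _.
  rewrite /g !patchE; congr (if _ then _ else _).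
  by rewrite in_setX xD.
rewrite integral0_eq// => y _.
by rewrite /g patchE in_setX (negbTE xD).
Qed.

Let gE2 y : \int[mu]_x g (x, y) = ((fun y => \int[mu]_(x in D1) f (x, y)) \_ D2) y.
Proof.
rewrite patchE; case: ifPn => yD.
  rewrite [RHS]integral_mkcond; apply: eq_integral => x _.
  rewrite /g !patchE; congr (if _ then _ else _).
  by rewrite in_setX yD andbT.
rewrite integral0_eq// => x _.
by rewrite /g patchE in_setX (negbTE yD) andbF.
Qed.

(** Tonelli's theorem on a rectangle, obtained by extending the integrand by
    zero. *)
Lemma restricted_tonelli :
  \int[mu]_(x in D1) \int[mu]_(y in D2) f (x, y) =
  \int[mu]_(y in D2) \int[mu]_(x in D1) f (x, y).
Proof.
rewrite [LHS]integral_mkcond [RHS]integral_mkcond.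
under eq_integral do rewrite -gE1.
under [RHS]eq_integral do rewrite -gE2.
exact: (@fubini_tonelli _ _ _ _ _ mu mu g mg g0).
Qed.

Lemma restricted_tonelli_measurable :
  measurable_fun D2 (fun y => \int[mu]_(x in D1) f (x, y)).
Proof.
apply/(measurable_restrictT _ mD2).
have := @measurable_fun_fubini_tonelli_G _ _ _ _ _ mu g mg g0.
by rewrite /fubini_G; under eq_fun do rewrite gE2.
Qed.

End RestrictedTonelli.

Section Arestov.
Local Open Scope classical_set_scope.
Context {R : realType}.
Notation mu := (@lebesgue_measure R).
Implicit Types (f g h P Q : {poly R[i]}) (b c z : R[i]).

Lemma horner_bounded f : exists2 M : R, 0 <= M &
  forall z, cmod z = 1 -> cmod f.[z] <= M.
Proof.
have [K fK] := horner_lipschitz f; exists (cmod f.[0] + `|K|).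
  by rewrite addr_ge0// cmod_ge0.
move=> z z1; have := fK z 0; rewrite z1 cmod0 subr0 lexx ler01 z1 mulr1.
move=> /(_ isT isT) fz.
rewrite -[f.[z]](subrK f.[0]) addrC (le_trans (cmodD _ _))// lerD2l.
by rewrite (le_trans fz)// ler_norm.
Qed.

(** The case [p = 0] of Arestov's theorem. Reflecting in the circle those zeros
    of [f] that lie inside does not change [|f|] on the circle, can only
    increase [|euler h f|] there, and makes both logarithmic means computable
    from the values at the origin.  The hypothesis [f.[0] != 0] keeps
    [euler h f] from vanishing identically, where [ln 0 = 0] would spoil the
    statement. *)
Lemma arestov_log n h f : admissible n h -> h.[0] = 1 ->
    (size f <= n.+1)%N -> f.[0] != 0 ->
  circle_mean (logabs (euler h f)) <= circle_mean (logabs f).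
Proof.
move=> hn h0 sf f0.
have nz (p : {poly R[i]}) : p.[0] != 0 -> p != 0.
  by apply: contraNneq => ->; rewrite horner0.
have [g [sg g0 fg gf]] := root_reflection (nz _ f0).
have sgn : (size g <= n.+1)%N := leq_trans sg sf.
have hg0 := hn g sgn g0.
have [_ jg] := jensen g0.
have [_ jhg] := jensen hg0.
have g00 : g.[0] != 0 by apply: g0; rewrite cmod0.
have -> : circle_mean (logabs f) = circle_mean (logabs g).
  by apply: eq_circle_mean => t; rewrite /logabs gf// cmod_expi.
rewrite jg (le_trans (le_circle_mean_logabs (g := euler h g) _ _ _))//.
- by apply: nz; rewrite euler_at0 h0 mul1r.
- by apply: nz; rewrite euler_at0 h0 mul1r.
- by move=> z z1; apply: (admissible_le hn).
- by rewrite jhg euler_at0 h0 mul1r.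
Qed.

Definition logmax f (s t : R) : R := ln (Num.max (cmod f.[expi t]) s).

Lemma measurable_logmax f s : measurable_fun [set: R] (logmax f s).
Proof.
apply: (@measurableT_comp _ _ _ _ _ _ (@ln R)).
  exact: measurable_ln.
apply: measurable_maxr; last exact: measurable_cst.
exact: measurable_cmod_horner_expi.
Qed.

Lemma logmax_integrable f s : 0 < s -> circle_integrable (logmax f s).
Proof.
move=> s0; have [M M0 fM] := horner_bounded f.
apply: (@circle_integrable_bounded _ _ (`|ln s| + `|ln (Num.max M s)|)).
  exact: measurable_logmax.
move=> t; have h1 : ln s <= logmax f s t.
  by rewrite ler_ln ?posrE// ?lt_max ?s0 ?orbT// le_max lexx orbT.
have h2 : logmax f s t <= ln (Num.max M s).
  rewrite ler_ln ?posrE ?lt_max ?s0 ?orbT// ge_max !le_max lexx orbT andbT.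
  by rewrite fM ?cmod_expi.
have := ler_norm (ln (Num.max M s)); have := ler_norm (- ln s).
have := normr_ge0 (ln s); have := normr_ge0 (ln (Num.max M s)).
by rewrite normrN ler_norml => *; apply/andP; split; lra.
Qed.

(** By Jensen's formula [ln (max |w| s)] is the mean of [ln |w + s e^{i u}|]
    over [u].  Exchanging the two means reduces the claim to [arestov_log] for
    the polynomials [f + s e^{i u}], since the operator commutes with adding a
    constant.  Their values at the origin are nonzero as [s <> |f(0)|]. *)
Lemma arestov_logmax n h f s : admissible n h -> h.[0] = 1 ->
    (size f <= n.+1)%N -> 0 < s -> s != cmod f.[0] ->
  circle_mean (logmax (euler h f) s) <= circle_mean (logmax f s).
Proof.
move=> hn h0 sf s0 sf0.
have [M1 M10 fM1] := horner_bounded f.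
have [M2 M20 fM2] := horner_bounded (euler h f).
(* [L] bounds the logarithms from above, so that Tonelli's theorem applies to
   the nonnegative [F]; the summand [1] makes [L] nonnegative, as needed where
   the argument of the logarithm vanishes and [ln 0 = 0]. *)
pose M := M1 + M2 + s + 1.
pose L := ln M.
have sC : cmod (s%:C%C) = s by rewrite cmod_real gtr0_norm.
pose F g (z : R * R) : R := L - ln (cmod (g.[expi z.1] + s%:C%C * expi z.2)).
pose small g := forall t, cmod g.[expi t] <= M1 + M2.
have sm1 : small f by move=> t; rewrite (le_trans (fM1 _ (cmod_expi t)))// lerDl.
have sm2 : small (euler h f).
  by move=> t; rewrite (le_trans (fM2 _ (cmod_expi t)))// lerDr.
have F0 g : small g -> forall z : R * R, 0 <= F g z.
  move=> sg z; rewrite subr_ge0.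
  set w := _ + _.
  have [->|w0] := eqVneq w 0; first by rewrite cmod0 ln0// ln_ge0// /M; lra.
  rewrite ler_ln ?posrE ?cmod_gt0//; last by rewrite /M; lra.
  rewrite (le_trans (cmodD _ _))// cmodM sC cmod_expi mulr1.
  by have := sg z.1; rewrite /M; lra.
have mF g : measurable_fun [set: R * R] (EFin \o F g).
  apply/measurable_EFinP; apply: measurable_funB => //.
  apply: (@measurableT_comp _ _ _ _ _ _ (@ln R)); first exact: measurable_ln.
  apply: measurable_cmod; apply: cmeasurableD.
    by apply: cmeasurable_horner; apply: cmeasurable_expi; exact: measurable_fst.
  apply: cmeasurableM; first exact: cmeasurable_cst.
  by apply: cmeasurable_expi; exact: measurable_snd.
have inner2 g t :
    (\int[mu]_(u in circle) (F g (t, u))%:E = (2 * pi * (L - logmax g s t))%:E)%E.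
  have [i j] := jensen_linear g.[expi t] s0.
  have i' := circle_integrableZ (-1) i.
  transitivity (\int[mu]_(u in circle)
      (L + (-1) * ln (cmod (g.[expi t] + s%:C%C * expi u)))%:E)%E.
    by apply: eq_integral => u _; rewrite /F /= mulN1r.
  rewrite (circle_meanE (circle_integrableD (circle_integrable_cst L) i')).
  rewrite (circle_meanD (circle_integrable_cst L) i') circle_meanZ// j.
  by rewrite circle_mean_cst mulN1r.
have total g : (\int[mu]_(t in circle) \int[mu]_(u in circle) (F g (t, u))%:E =
    (2 * pi * (2 * pi * (L - circle_mean (logmax g s))))%:E)%E.
  have il := circle_integrableZ (-1) (logmax_integrable g s0).
  have il' := circle_integrableD (circle_integrable_cst L) il.
  transitivity (\int[mu]_(t in circle)
      (2 * pi * (L + (-1) * logmax g s t))%:E)%E.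
    by apply: eq_integral => t _; rewrite inner2 mulN1r.
  rewrite (circle_meanE (circle_integrableZ _ il')) circle_meanZ//.
  rewrite (circle_meanD (circle_integrable_cst L) il).
  by rewrite circle_meanZ ?circle_mean_cst ?mulN1r//; exact: logmax_integrable.
pose shift g u : {poly R[i]} := g + (s%:C%C * expi u)%:P.
have shift0 g u : cmod g.[0] = cmod f.[0] -> (shift g u).[0] != 0.
  move=> gf; rewrite /shift hornerD hornerC addr_eq0.
  apply: contra sf0 => /eqP gE; rewrite -gf gE cmodN cmodM sC cmod_expi.
  by rewrite mulr1.
have inner1 g u : cmod g.[0] = cmod f.[0] ->
    (\int[mu]_(t in circle) (F g (t, u))%:E =
     (2 * pi * (L - circle_mean (logabs (shift g u))))%:E)%E.
  move=> gf; have g0 : shift g u != 0.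
    by apply: contraNneq (shift0 g u gf) => ->; rewrite horner0.
  have i := logabs_integrable g0.
  have i' := circle_integrableZ (-1) i.
  transitivity (\int[mu]_(t in circle) (L + (-1) * logabs (shift g u) t)%:E)%E.
    by apply: eq_integral => t _; rewrite /F /= mulN1r /logabs /shift hornerD hornerC.
  rewrite (circle_meanE (circle_integrableD (circle_integrable_cst L) i')).
  rewrite (circle_meanD (circle_integrable_cst L) i') circle_meanZ//.
  by rewrite circle_mean_cst mulN1r.
have hf0 : cmod (euler h f).[0] = cmod f.[0] by rewrite euler_at0 h0 mul1r.
have key : (\int[mu]_(t in circle) \int[mu]_(u in circle) (F f (t, u))%:E <=
    \int[mu]_(t in circle) \int[mu]_(u in circle) (F (euler h f) (t, u))%:E)%E.
  have T g : small g -> (\int[mu]_(t in circle) \int[mu]_(u in circle) (F g (t, u))%:E =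
      \int[mu]_(u in circle) \int[mu]_(t in circle) (F g (t, u))%:E)%E.
    move=> sg; apply: (@restricted_tonelli R circle circle (EFin \o F g)) => //.
    by move=> z; rewrite lee_fin F0.
  have mT g : small g -> measurable_fun circle
      (fun u => \int[mu]_(t in circle) (F g (t, u))%:E)%E.
    move=> sg.
    apply: (@restricted_tonelli_measurable R circle circle (EFin \o F g)) => //.
    by move=> z; rewrite lee_fin F0.
  rewrite (T _ sm1) (T _ sm2); apply: ge0_le_integral => //.
  - by move=> u _; apply: integral_ge0 => t _; rewrite lee_fin F0.
  - exact: mT.
  - exact: mT.
  move=> u _; rewrite !inner1// lee_fin ler_pM2l ?twopi_gt0// lerD2l lerN2.
  have -> : shift (euler h f) u = euler h (shift f u).
    by rewrite /shift eulerDr euler_const h0 mul1r.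
  apply: (arestov_log hn h0); last exact: shift0.
  rewrite (leq_trans (size_polyD _ _))// geq_max sf.
  by rewrite (leq_trans (size_polyC_leq1 _)).
move: key; rewrite !total lee_fin 2!(ler_pM2l twopi_gt0).
by rewrite lerD2l lerN2.
Qed.

End Arestov.

Section LayerCake.
Local Open Scope classical_set_scope.
Context {R : realType}.
Notation mu := (@lebesgue_measure R).
Variable p : R.
Hypothesis p0 : 0 < p.

(** [max (ln x + v, 0) e^{-p v}], written so as to make sense at [x = 0]. *)
Definition layer (x v : R) : R :=
  (ln (Num.max x (expR (- v))) + v) * expR (- (p * v)).

Let max_gt0 (x v : R) : 0 < Num.max x (expR (- v)).
Proof. by rewrite lt_max expR_gt0 orbT. Qed.

Lemma layer_ge0 (x v : R) : 0 <= layer x v.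
Proof.
rewrite mulr_ge0 ?expR_ge0// -lerBlDr sub0r -[leLHS]expRK.
by rewrite ler_ln ?posrE ?expR_gt0// le_max lexx orbT.
Qed.

Lemma measurable_layer (d : measure_display) (T : measurableType d) (x v : T -> R) :
    measurable_fun [set: T] x -> measurable_fun [set: T] v ->
  measurable_fun [set: T] (fun t => layer (x t) (v t)).
Proof.
have me (w : T -> R) : measurable_fun [set: T] w ->
    measurable_fun [set: T] (fun t => expR (- w t : R)).
  move=> mw; apply: (@measurableT_comp _ _ _ _ _ _ (@expR R)).
    exact: measurable_expR.
  exact: measurableT_comp.
move=> mx mv; apply: measurable_funM; last first.
  by apply: me; exact: measurable_funM.
apply: measurable_funD => //; apply: (@measurableT_comp _ _ _ _ _ _ (@ln R)).
  exact: measurable_ln.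
by apply: measurable_maxr => //; exact: me.
Qed.

Let mlayer (x : R) : measurable_fun [set: measurableTypeR R] (EFin \o layer x).
Proof.
apply/measurable_EFinP; apply: (@measurable_layer _ (measurableTypeR R) (cst x) idfun).
  exact: measurable_cst.
exact: measurable_id.
Qed.

Lemma layer0 (v : R) : layer 0 v = 0.
Proof.
by rewrite /layer max_r ?expR_ge0// expRK addNr mul0r.
Qed.

Lemma layer_shift (x v : R) : 0 < x -> layer x v = layer 1 (v + ln x) * x `^ p.
Proof.
move=> x0; rewrite /layer mulrAC -mulrA.
have -> : x `^ p = expR (p * ln x) by rewrite /powR gt_eqF.
rewrite -expRD; congr (_ * expR _); last by ring.
have -> : expR (- (v + ln x)) = x^-1 * expR (- v).
  by rewrite opprD expRD [expR (- ln x)]expRN lnK ?posrE// mulrC.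
have -> : Num.max x (expR (- v)) = x * Num.max 1 (x^-1 * expR (- v)).
  by rewrite maxr_pMr ?(ltW x0)// mulr1 mulrA divff ?gt_eqF// mul1r.
rewrite lnM ?posrE//; last by rewrite lt_max ltr01.
by ring.
Qed.

(** [v e^{-p v}] is at most a multiple of [e^{-p v / 2}]. *)
Let layer1_le (v : R) : layer 1 v <= (2 / p) ^+ 2 * exponential_pdf (p / 2) v.
Proof.
have p2 : 0 < p / 2 by rewrite divr_gt0.
have [v0|v0] := ltP v 0.
  rewrite lt0_exponential_pdf// mulr0 /layer max_r; last first.
    by rewrite -[leLHS]expR0 ler_expR oppr_ge0 ltW.
  by rewrite expRK addNr mul0r.
rewrite exponential_pdfE// /layer max_l; last first.
  by rewrite -[leRHS]expR0 ler_expR oppr_le0.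
rewrite ln1 add0r.
have -> : - (p * v) = - (p / 2) * v + - (p / 2 * v) by field.
rewrite expRD; set a := expR (- (p / 2) * v); set b := expR _.
have b2 : v * b <= 2 / p.
  have h : p / 2 * v <= expR (p / 2 * v).
    by have := expR_ge1Dx (p / 2 * v); lra.
  rewrite /b expRN ler_pdivrMr ?expR_gt0//.
  rewrite -(ler_pM2l p2) mulrA (_ : p / 2 * (2 / p) = 1) ?mul1r//.
  by field; rewrite gt_eqF.
have -> : (2 / p) ^+ 2 * (p / 2 * a) = 2 / p * a.
  by rewrite mulrA; congr (_ * _); field; rewrite gt_eqF.
by rewrite [a * b]mulrC mulrA ler_wpM2r// expR_ge0.
Qed.

Let layer1_ge (v : R) : 1 <= v <= 2 -> expR (- (p * 2)) <= layer 1 v.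
Proof.
move=> /andP[v1 v2]; rewrite /layer max_l; last first.
  by rewrite -[leRHS]expR0 ler_expR; lra.
rewrite ln1 add0r -[leLHS]mul1r ler_pM ?expR_ge0// ler_expR lerN2.
by rewrite ler_pM2l.
Qed.

(** The powers are mixtures of the functions [max (ln x + v, 0)]: by translation
    invariance, replacing [x = 1] by [x] multiplies the integral by [x^p]. *)
Lemma powR_layer_cake : exists2 C : R, 0 < C & forall x, 0 <= x ->
  (\int[mu]_v (layer x v)%:E = (C * x `^ p)%:E)%E.
Proof.
have p2 : 0 < p / 2 by rewrite divr_gt0.
pose I := (\int[mu]_v (layer 1 v)%:E)%E.
have Ioo : (I < +oo)%E.
  apply: (@le_lt_trans _ _
    (\int[mu]_v ((2 / p) ^+ 2 * exponential_pdf (p / 2) v)%:E)%E).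
    apply: ge0_le_integral => //.
    - by move=> v _; rewrite lee_fin layer_ge0.
    - exact: mlayer.
    - apply/measurable_EFinP; apply: measurable_funM => //.
      exact: measurable_exponential_pdf.
    - by move=> v _; rewrite lee_fin layer1_le.
  under eq_integral do rewrite EFinM.
  rewrite ge0_integralZl//.
  - by rewrite integral_exponential_pdf// mule1 ltry.
  - by apply/measurable_EFinP; exact: measurable_exponential_pdf.
  - by move=> v _; rewrite lee_fin exponential_pdf_ge0// ltW.
  - by rewrite lee_fin sqr_ge0.
have I0 : (0 < I)%E.
  apply: (@lt_le_trans _ _ (\int[mu]_(v in `[1%R, 2%R]) (expR (- (p * 2)))%:E)%E).
    rewrite integral_cst//= lebesgue_measure_itv/= lte_fin ltr1n -EFinD.
    by rewrite mule_gt0 ?lte_fin ?expR_gt0//; lra.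
  apply: (@le_trans _ _ (\int[mu]_(v in `[1%R, 2%R]) (layer 1 v)%:E)%E).
    by apply: ge0_le_integral => //; exact: measurable_funTS (mlayer 1).
  apply: ge0_subset_integral => //; first exact: mlayer.
  by move=> v _; rewrite lee_fin layer_ge0.
have Ifin : I \is a fin_num by rewrite ge0_fin_numE// ltW.
exists (fine I); first by rewrite fine_gt0// I0.
move=> x; rewrite le_eqVlt => /predU1P[<-|x0].
  rewrite powR0 ?gt_eqF// mulr0 integral0_eq// => v _.
  by rewrite layer0.
rewrite EFinM fineK//.
transitivity (\int[mu]_v ((x `^ p)%:E * (layer 1 (v + ln x))%:E))%E.
  by apply: eq_integral => v _; rewrite layer_shift// mulrC EFinM.
have ms : measurable_fun [set: measurableTypeR R] (fun v => (layer 1 (v + ln x))%:E).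
  apply/measurable_EFinP.
  apply: (@measurable_layer _ (measurableTypeR R) (cst 1) (fun v => v + ln x)).
    exact: measurable_cst.
  exact: measurable_funD.
rewrite ge0_integralZl//; last 2 first.
  - by move=> v _; rewrite lee_fin layer_ge0.
  - by rewrite lee_fin powR_ge0.
rewrite muleC; congr (_ * _)%E.
rewrite /I (@ge0_integral_affine _ 1 (ln x))//; last 2 first.
  - exact: mlayer.
  - by move=> v; rewrite lee_fin layer_ge0.
rewrite mul1e preimage_setT; apply: eq_integral => v _.
by rewrite mul1r.
Qed.

End LayerCake.

Section ArestovPower.
Local Open Scope classical_set_scope.
Context {R : realType}.
Notation mu := (@lebesgue_measure R).
Implicit Types (f g h P Q : {poly R[i]}).

Lemma cmod_powR_integrable f (p : R) : 0 < p ->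
  circle_integrable (fun t => cmod f.[expi t] `^ p).
Proof.
move=> p0; have [M M0 fM] := horner_bounded f.
apply: (@circle_integrable_bounded _ _ (M `^ p)).
  apply: (@measurableT_comp _ _ _ _ _ _ (fun x : R => x `^ p)).
    exact: measurable_powR.
  exact: measurable_cmod_horner_expi.
move=> t; rewrite ger0_norm ?powR_ge0// ge0_ler_powR ?nnegrE ?(ltW p0)//.
  exact: cmod_ge0.
by rewrite fM ?cmod_expi.
Qed.

Let layer_integral f (p : R) v :
  (\int[mu]_(t in circle) (layer p (cmod f.[expi t]) v)%:E =
   (2 * pi * (expR (- (p * v)) * (circle_mean (logmax f (expR (- v))) + v)))%:E)%E.
Proof.
have il := logmax_integrable f (expR_gt0 (- v)).
have il' := circle_integrableD il (circle_integrable_cst v).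
transitivity (\int[mu]_(t in circle)
    (expR (- (p * v)) * (logmax f (expR (- v)) t + v))%:E)%E.
  by apply: eq_integral => t _; rewrite /layer mulrC.
rewrite (circle_meanE (circle_integrableZ _ il')) (circle_meanZ _ il').
by rewrite (circle_meanD il (circle_integrable_cst v)) circle_mean_cst.
Qed.

(** Write both sides as mixtures by [powR_layer_cake]; [arestov_logmax] compares
    them for all [v] but the one with [e^{-v} = |f(0)|]. *)
Let arestov_normalized n h f (p : R) : 0 < p -> admissible n h -> h.[0] = 1 ->
    (size f <= n.+1)%N ->
  circle_mean (fun t => cmod (euler h f).[expi t] `^ p) <=
  circle_mean (fun t => cmod f.[expi t] `^ p).
Proof.
move=> p0 hn h0 sf; have [C C0 cake] := powR_layer_cake p0.
have mG g : measurable_fun [set: R * R]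
    (fun z : R * R => (layer p (cmod g.[expi z.1]) z.2)%:E).
  apply/measurable_EFinP; apply: measurable_layer; last exact: measurable_snd.
  apply: measurable_cmod; apply: cmeasurable_horner; apply: cmeasurable_expi.
  exact: measurable_fst.
have G0 g (z : R * R) : (0 <= (layer p (cmod g.[expi z.1]) z.2)%:E)%E.
  by rewrite lee_fin layer_ge0.
have E g : (\int[mu]_v \int[mu]_(t in circle) (layer p (cmod g.[expi t]) v)%:E =
    (2 * pi * (C * circle_mean (fun t => (cmod g.[expi t] `^ p)%R)))%:E)%E.
  rewrite -(restricted_tonelli measurable_circle measurableT (mG g) (G0 g)).
  transitivity (\int[mu]_(t in circle) (C * cmod g.[expi t] `^ p)%:E)%E.
    by apply: eq_integral => t _; rewrite /= cake ?cmod_ge0.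
  have ip := cmod_powR_integrable g p0.
  by rewrite (circle_meanE (circle_integrableZ _ ip)) (circle_meanZ _ ip).
suff : (\int[mu]_v \int[mu]_(t in circle) (layer p (cmod (euler h f).[expi t]) v)%:E <=
    \int[mu]_v \int[mu]_(t in circle) (layer p (cmod f.[expi t]) v)%:E)%E.
  by rewrite !E lee_fin (ler_pM2l twopi_gt0) (ler_pM2l C0).
have m g := restricted_tonelli_measurable measurable_circle measurableT (mG g) (G0 g).
apply: ae_ge0_le_integral => //.
- by move=> v _; apply: integral_ge0 => t _; rewrite lee_fin layer_ge0.
- exact: m.
- by move=> v _; apply: integral_ge0 => t _; rewrite lee_fin layer_ge0.
- exact: m.
exists [set - ln (cmod f.[0])]; split.
- exact: measurable_set1.
- exact: lebesgue_measure_set1.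
- move=> v /= nv; apply: contrapT => vne; apply: nv => _.
  rewrite !layer_integral lee_fin (ler_pM2l twopi_gt0).
  rewrite ler_wpM2l ?expR_ge0// lerD2r.
  apply: arestov_logmax hn h0 sf _ _; first exact: expR_gt0.
  by apply/eqP => vE; apply: vne; rewrite -vE expRK opprK.
Qed.

Lemma arestov n h f (p : R) : 0 < p -> admissible n h -> h.[0] != 0 ->
    (size f <= n.+1)%N ->
  circle_mean (fun t => cmod (euler h f).[expi t] `^ p) <=
  cmod h.[0] `^ p * circle_mean (fun t => cmod f.[expi t] `^ p).
Proof.
move=> p0 hn h0 sf; pose k := h.[0]^-1 *: h.
have hE : h = h.[0] *: k by rewrite scalerA divff// scale1r.
have kn : admissible n k.
  move=> g sg g0 y y1; rewrite eulerZl hornerZ mulf_neq0 ?invr_eq0//.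
  exact: hn.
have k0 : k.[0] = 1 by rewrite hornerZ mulVf.
rewrite -(circle_meanZ _ (cmod_powR_integrable f p0)).
have -> : (fun t => cmod (euler h f).[expi t] `^ p) =
    (fun t => cmod h.[0] `^ p * cmod (euler k f).[expi t] `^ p).
  apply/funext => t; rewrite {1}hE eulerZl hornerZ cmodM powRM//; exact: cmod_ge0.
rewrite (circle_meanZ _ (cmod_powR_integrable _ p0)).
rewrite (circle_meanZ _ (cmod_powR_integrable _ p0)).
by rewrite ler_wpM2l ?powR_ge0// (arestov_normalized p0 kn k0 sf).
Qed.

End ArestovPower.

(** * Norms of binomials *)

Section LinearMeans.
Local Open Scope classical_set_scope.
Context {R : realType}.
Implicit Types (a b c : R[i]) (phi : R -> R).

Lemma measurable_comp_cmod_linear phi a b : measurable_fun [set: R] phi ->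
  measurable_fun [set: R] (fun t => phi (cmod (a * expi t + b))).
Proof.
move=> mphi; apply: (measurableT_comp mphi); apply: measurable_cmod.
apply: cmeasurableD; last exact: cmeasurable_cst.
apply: cmeasurableM; first exact: cmeasurable_cst.
by apply: cmeasurable_expi; exact: measurable_id.
Qed.

(** Rotating the circle removes the arguments of the coefficients. *)
Lemma circle_mean_linear phi a b : measurable_fun [set: R] phi ->
  circle_mean (fun t => phi (cmod (a * expi t + b))) =
  circle_mean (fun t => phi (cmod ((cmod a)%:C%C * expi t + (cmod b)%:C%C))).
Proof.
move=> mphi; have [s _ aE] := polar a; have [u _ bE] := polar b.
have [|c cI cE] := @unit_expi R (expi s / expi u).
  by rewrite cmodM cmodV !cmod_expi invr1 mulr1.
rewrite -[RHS](circle_mean_rotation _ _ cI).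
- apply: eq_circle_mean => t; congr phi.
  rewrite {1}aE {1}bE -[LHS]mulr1 -(cmod_expi (- u)) -cmodM; congr cmod.
  have cE' : expi c = expi s * expi (- u) by rewrite -cE expiN expiC.
  have uu : expi u * expi (- u) = 1 by rewrite -expiD subrr expi0.
  rewrite expiD cE' mulrDl -[in RHS](mulr1 (cmod b)%:C%C) -uu.
  by ring.
- exact: measurable_comp_cmod_linear.
- by move=> t; rewrite expi_periodic.
Qed.

Lemma cmod_real_linear_swap (x y t : R) :
  cmod (x%:C%C * expi t + y%:C%C) = cmod (y%:C%C * expi t + x%:C%C).
Proof.
apply/eqP; rewrite -(@eqrXn2 _ 2)// ?cmod_ge0//; apply/eqP.
rewrite !cmod_sqr !ReImE /=; apply: subr0_eq.
transitivity ((x ^+ 2 - y ^+ 2) * (cos t ^+ 2 + sin t ^+ 2 - 1)); first by ring.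
by rewrite cos2Dsin2 subrr mulr0.
Qed.

Lemma circle_mean_linear_swap phi a b : measurable_fun [set: R] phi ->
  circle_mean (fun t => phi (cmod (a * expi t + b))) =
  circle_mean (fun t => phi (cmod (b * expi t + a))).
Proof.
move=> mphi; rewrite circle_mean_linear// [RHS]circle_mean_linear//.
by apply: eq_circle_mean => t; rewrite cmod_real_linear_swap.
Qed.

(** [e^{i t}] and [e^{i n t}] are equidistributed on the circle. *)
Lemma circle_mean_binomial phi n a b : (0 < n)%N -> measurable_fun [set: R] phi ->
  circle_mean (fun t => phi (cmod (a * expi t ^+ n + b))) =
  circle_mean (fun t => phi (cmod (a * expi t + b))).
Proof.
move=> n0 mphi; rewrite -[RHS](circle_mean_dilation _ _ n0).
- by apply: eq_circle_mean => t; rewrite expiMn.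
- exact: measurable_comp_cmod_linear.
- by move=> t; rewrite expi_periodic.
Qed.

End LinearMeans.

Section Norms.
Local Open Scope classical_set_scope.
Context {R : realType}.
Implicit Types (f g h P : {poly R[i]}) (a b c : R[i]) (p : R).

Definition pmean p f : R := circle_mean (fun t => cmod f.[expi t] `^ p).

Lemma pmean_ge0 p f : 0 <= pmean p f.
Proof. by apply: circle_mean_ge0 => t; exact: powR_ge0. Qed.

Lemma pnorm_ge0 p f : 0 <= pnorm p f.
Proof.
rewrite /pnorm /mahler; case: ifP => _; last exact: powR_ge0.
by case: ifP => // _; exact: expR_ge0.
Qed.

Lemma pnorm_pmean p f : 0 < p -> pnorm p f = pmean p f `^ p^-1.
Proof. by move=> p0; rewrite /pnorm gt_eqF. Qed.

Lemma pnorm0_logabs f : f != 0 -> pnorm 0 f = expR (circle_mean (logabs f)).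
Proof. by move=> f0; rewrite /pnorm eqxx /mahler (negbTE f0). Qed.

Lemma pnorm_ext p f g : (f == 0) = (g == 0) ->
    (forall phi : R -> R, measurable_fun [set: R] phi ->
      circle_mean (fun t => phi (cmod f.[expi t])) =
      circle_mean (fun t => phi (cmod g.[expi t]))) ->
  pnorm p f = pnorm p g.
Proof.
move=> fg0 fg; rewrite /pnorm /mahler fg0 fg; last exact: measurable_ln.
by rewrite (fg (fun x => x `^ p))//; exact: measurable_powR.
Qed.

Lemma pnormZ p c f : 0 <= p -> pnorm p (c *: f) = cmod c * pnorm p f.
Proof.
rewrite le_eqVlt => /predU1P[<-|p0].
  have [->|c0] := eqVneq c 0.
    by rewrite scale0r cmod0 mul0r /pnorm eqxx /mahler eqxx.
  have [->|f0] := eqVneq f 0.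
    by rewrite scaler0 /pnorm eqxx /mahler eqxx mulr0.
  rewrite !pnorm0_logabs ?scaler_eq0 ?negb_or ?c0//.
  rewrite -[cmod c in RHS]lnK ?posrE ?cmod_gt0// -expRD; congr expR.
  rewrite -[ln (cmod c)]circle_mean_cst.
  rewrite -(circle_meanD (circle_integrable_cst _) (logabs_integrable f0)).
  apply: (ae_circle_mean f0) => //.
    by apply: measurable_funD => //; exact: measurable_logabs.
  move=> t ft; rewrite /logabs hornerZ cmodM lnM ?posrE ?cmod_gt0//.
rewrite !pnorm_pmean//.
have -> : pmean p (c *: f) = cmod c `^ p * pmean p f.
  rewrite /pmean -circle_meanZ; last exact: cmod_powR_integrable.
  by apply: eq_circle_mean => t; rewrite hornerZ cmodM powRM// cmod_ge0.
rewrite powRM ?powR_ge0 ?pmean_ge0// -powRrM divff ?gt_eqF// powRr1//.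
exact: cmod_ge0.
Qed.

Lemma linear_eq0 n a b : (0 < n)%N ->
  (a *: 'X^n + b%:P == 0) = (a == 0) && (b == 0).
Proof.
move=> n0; apply/eqP/andP => [/polyP ab|[/eqP-> /eqP->]].
  split.
    by have := ab n; rewrite coefD coefZ coefXn eqxx mulr1 coefC gtn_eqF// addr0 coef0 => ->.
  have := ab 0%N; rewrite coefD coefZ coefXn coefC eqxx (ltn_eqF n0) mulr0 add0r.
  by rewrite coef0 => ->.
by rewrite scale0r add0r.
Qed.

Lemma pnorm_binomial p n a b a' b' : (0 < n)%N ->
    cmod a = cmod a' -> cmod b = cmod b' ->
  pnorm p (a *: 'X^n + b%:P) = pnorm p (a' *: 'X + b'%:P).
Proof.
move=> n0 aa bb; apply: pnorm_ext.
  by rewrite -['X in RHS]expr1 !linear_eq0// -!cmod_eq0 aa bb.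
move=> phi mphi.
transitivity (circle_mean (fun t => phi (cmod (a * expi t ^+ n + b)))).
  by apply: eq_circle_mean => t; rewrite !hornerE.
rewrite circle_mean_binomial// circle_mean_linear// aa bb -circle_mean_linear//.
by apply: eq_circle_mean => t; rewrite !hornerE.
Qed.

Lemma pnorm_linear_swap p a b :
  pnorm p (a *: 'X + b%:P) = pnorm p (b *: 'X + a%:P).
Proof.
apply: pnorm_ext; first by rewrite -['X]expr1 !linear_eq0// andbC.
move=> phi mphi.
transitivity (circle_mean (fun t => phi (cmod (a * expi t + b)))).
  by apply: eq_circle_mean => t; rewrite !hornerE.
rewrite circle_mean_linear_swap//.
by apply: eq_circle_mean => t; rewrite !hornerE.
Qed.

Lemma mahler_zero_free f : zero_free f -> pnorm 0 f = cmod f.[0].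
Proof.
move=> f0; have f00 : f.[0] != 0 by apply: f0; rewrite cmod0.
rewrite pnorm0_logabs; last by apply: contraNneq f00 => ->; rewrite horner0.
by have [_ ->] := jensen f0; rewrite lnK// posrE cmod_gt0.
Qed.

Lemma mahler_linear_ge a b : cmod a <= pnorm 0 (a *: 'X + b%:P).
Proof.
have [->|a0] := eqVneq a 0; first by rewrite cmod0 pnorm_ge0.
have a1 : 0 < cmod a by rewrite cmod_gt0.
rewrite (@pnorm_binomial 0 1 a b (cmod a)%:C%C b)//; last first.
  by rewrite cmod_real ger0_norm ?cmod_ge0.
rewrite pnorm0_logabs; last first.
  by rewrite -['X]expr1 linear_eq0// -cmod_eq0 cmod_real normr_eq0 gt_eqF.
have [_ jE] := jensen_linear b a1.
have -> : circle_mean (logabs ((cmod a)%:C%C *: 'X + b%:P)) =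
    ln (Num.max (cmod b) (cmod a)).
  rewrite -jE; apply: eq_circle_mean => t.
  by rewrite /logabs !hornerE addrC.
by rewrite lnK ?posrE ?lt_max ?a1 ?orbT// le_max lexx orbT.
Qed.

Lemma zero_free_linear (x : R) : `|x| <= 1 -> zero_free (x%:C%C *: 'X + 1).
Proof.
move=> x1 y y1; rewrite !hornerE addr_eq0; apply/eqP => /(congr1 (@cmod R)).
rewrite cmodN cmod1 cmodM cmod_real => xy.
by have := normr_ge0 x; have := cmod_ge0 y; nra.
Qed.

Lemma mahler_1X : pnorm 0 (1 + 'X : {poly R[i]}) = 1.
Proof.
have := @zero_free_linear 1; rewrite normr1 lexx rmorph1 scale1r addrC => /(_ isT).
by move=> /mahler_zero_free ->; rewrite !hornerE cmod1.
Qed.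

(** Since [x^p >= 1 + p ln x], the mean of the power is at least one plus [p]
    times the logarithmic mean, which vanishes here. *)
Lemma pmean_1X_gt0 p : 0 < p -> 0 < pmean p (1 + 'X : {poly R[i]}).
Proof.
move=> p0; have z1 : zero_free ('X + 1 : {poly R[i]}).
  by have := @zero_free_linear 1; rewrite normr1 lexx rmorph1 scale1r; apply.
have [i j] := jensen z1.
have f0 : 'X + 1 != 0 :> {poly R[i]}.
  apply/eqP => /(congr1 (fun q : {poly R[i]} => q.[0])).
  by rewrite !hornerE => /eqP; rewrite oner_eq0.
rewrite addrC (lt_le_trans ltr01)//.
have ip := circle_integrableZ p i.
have <- : circle_mean (fun t => 1 + p * logabs ('X + 1) t) = 1.
  rewrite (circle_meanD (circle_integrable_cst _) ip) (circle_meanZ _ i) j.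
  by rewrite circle_mean_cst !hornerE cmod1 ln1 mulr0 addr0.
apply: (ae_le_circle_mean f0).
- apply: measurable_funD => //; apply: measurable_funM => //.
  exact: measurable_logabs.
- apply: (@measurableT_comp _ _ _ _ _ _ (fun x : R => x `^ p)).
    exact: measurable_powR.
  exact: measurable_cmod_horner_expi.
- exact: circle_integrableD (circle_integrable_cst _) ip.
- exact: cmod_powR_integrable.
move=> t ft; rewrite /powR cmod_eq0 (negbTE ft).
exact: expR_ge1Dx.
Qed.

Lemma pnorm_1X_gt0 p : 0 <= p -> 0 < pnorm p (1 + 'X : {poly R[i]}).
Proof.
rewrite le_eqVlt => /predU1P[<-|p0]; first by rewrite mahler_1X.
by rewrite pnorm_pmean// powR_gt0// pmean_1X_gt0.
Qed.

End Norms.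

(** * The inequality and its sharpness *)

Section Main.
Local Open Scope classical_set_scope.
Context {R : realType}.
Notation mu := (@lebesgue_measure R).
Implicit Types (f g h P q : {poly R[i]}) (a b c : R[i]) (s : seq R[i]) (p : R).

Lemma admissible_roots n h : (0 < n)%N -> h != 0 ->
  (forall b, root h b -> n%:R / 2 <= complex.Re b) -> admissible n h.
Proof.
move=> n0 h0 hb g sg g0 y y1; apply: (euler_neq0 n0 h0 hb sg) => x xy.
by apply: g0; exact: le_lt_trans xy y1.
Qed.

Lemma euler0 f : euler 0 f = 0.
Proof. by rewrite -[X in euler X](scale0r (1 : {poly R[i]})) eulerZl scale0r. Qed.

Lemma arestov_roots n h f p : (0 < n)%N -> 0 < p ->
    (forall b, h != 0 -> root h b -> n%:R / 2 <= complex.Re b) ->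
    (size f <= n.+1)%N ->
  pmean p (euler h f) <= cmod h.[0] `^ p * pmean p f.
Proof.
move=> n0 p0 hb sf; have [->|h0] := eqVneq h 0.
  rewrite euler0 horner0 cmod0 powR0 ?gt_eqF// mul0r /pmean.
  under eq_fun do rewrite horner0 cmod0 powR0 ?gt_eqF//.
  by rewrite circle_mean_cst.
have hb' b : root h b -> n%:R / 2 <= complex.Re b by exact: hb.
apply: (arestov p0 (admissible_roots n0 h0 hb') _ sf).
apply/negP => h00; have : n%:R / 2 <= complex.Re (0 : R[i]) by apply: hb'.
by rewrite leNgt divr_gt0// ltr0n.
Qed.

(** The difference of the squares is [(y - x) (y - x + 2 x (1 + cos t))]. *)
Lemma le_cmod_linear (x y t : R) : 0 <= x <= y ->
  x * cmod (1 + expi t) <= cmod (x%:C%C * expi t + y%:C%C).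
Proof.
move=> /andP[x0 xy]; rewrite -(@ler_pXn2r _ 2)// ?nnegrE ?mulr_ge0 ?cmod_ge0//.
rewrite exprMn !cmod_sqr !ReImE /=; have cs := cos2Dsin2 t.
have c1 : -1 <= cos t by rewrite cos_geN1.
rewrite -subr_ge0.
have -> : (x * cos t - 0 * sin t + y) ^+ 2 + (x * sin t + 0 * cos t + 0) ^+ 2 -
    x ^+ 2 * ((1 + cos t) ^+ 2 + (0 + sin t) ^+ 2) =
    (y - x) * (y - x + 2 * x * (1 + cos t)).
  rewrite -[RHS]addr0.
  have -> : 0 = 0 * (cos t ^+ 2 + sin t ^+ 2 - 1) by rewrite mul0r.
  by ring.
by rewrite mulr_ge0 ?subr_ge0// addr_ge0 ?subr_ge0// !mulr_ge0//; lra.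
Qed.

(** Averaging over [u] the bound for the operator [q' + e^{i u} q], where [q']
    has the mirrored roots: on the left the mean in [u] of
    [|B + e^{i u} A|^p], with [|A| <= |B|], is at least the mean of
    [|A|^p |1 + e^{i u}|^p]. *)
Lemma pmean_euler_le n s P p : (0 < n)%N -> 0 < p ->
    (forall a, a \in s -> complex.Re a <= n%:R / 2) ->
    (size P <= n.+1)%N -> (forall z, cmod z <= 1 -> P.[z] != 0) ->
  pmean p (euler (roots_at s) P) * pmean p (1 + 'X) <=
  pmean p ((roots_at s).[0] *: 'X + (roots_at [seq mirror n a | a <- s]).[0]%:P) *
  pmean p P.
Proof.
move=> n0 p0 sn sP P0.
set q := roots_at s; set q' := roots_at _.
set A := euler q P; pose B := euler q' P.
have AB t : cmod A.[expi t] <= cmod B.[expi t].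
  apply: euler_le_mirror => // y; rewrite cmod_expi; exact: P0.
have mp : measurable_fun [set: R] (fun x : R => x `^ p) by exact: measurable_powR.
pose F (z : R * R) := cmod (A.[expi z.1] * expi z.2 + B.[expi z.1]) `^ p.
have mF : measurable_fun [set: R * R] (EFin \o F).
  apply/measurable_EFinP; apply: (measurableT_comp mp); apply: measurable_cmod.
  have m1 f : cmeasurable (fun z : R * R => f.[expi z.1]).
    by apply: cmeasurable_horner; apply: cmeasurable_expi; exact: measurable_fst.
  apply: cmeasurableD => //; apply: cmeasurableM => //.
  by apply: cmeasurable_expi; exact: measurable_snd.
have F0 z : (0 <= (EFin \o F) z)%E by rewrite lee_fin powR_ge0.
have mF' : measurable_fun [set: R * R] (fun z => (F (z.2, z.1))%:E).
  by apply: (measurableT_comp mF); exact: measurable_swap.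
have F0' (z : R * R) : (0 <= (F (z.2, z.1))%:E)%E by exact: F0.
pose K := pmean p (1 + 'X : {poly R[i]}).
have iA := cmod_powR_integrable A p0.
have iF t : circle_integrable (fun u => F (t, u)).
  have := cmod_powR_integrable (A.[expi t] *: 'X + B.[expi t]%:P) p0.
  by congr circle_integrable; apply/funext => u; rewrite /F !hornerE.
have lower t : cmod A.[expi t] `^ p * K <= circle_mean (fun u => F (t, u)).
  have -> : circle_mean (fun u => F (t, u)) = circle_mean (fun u =>
      cmod ((cmod A.[expi t])%:C%C * expi u + (cmod B.[expi t])%:C%C) `^ p).
    exact: (circle_mean_linear A.[expi t] B.[expi t] mp).
  have iK := cmod_powR_integrable (1 + 'X) p0.
  rewrite /K /pmean -(circle_meanZ _ iK); apply: le_circle_mean.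
  - exact: circle_integrableZ.
  - have := cmod_powR_integrable
      ((cmod A.[expi t])%:C%C *: 'X + (cmod B.[expi t])%:C%C%:P) p0.
    by congr circle_integrable; apply/funext => u; rewrite !hornerE.
  - move=> u; rewrite -powRM ?cmod_ge0// ge0_ler_powR ?nnegrE ?(ltW p0)//.
    + by rewrite mulr_ge0 ?cmod_ge0.
    + exact: cmod_ge0.
    + by rewrite !hornerE; apply: le_cmod_linear; rewrite cmod_ge0 AB.
have upper u : circle_mean (fun t => F (t, u)) <=
    cmod (q.[0] * expi u + q'.[0]) `^ p * pmean p P.
  pose h := q' + expi u *: q.
  have -> : circle_mean (fun t => F (t, u)) = pmean p (euler h P).
    apply: eq_circle_mean => t; rewrite /F /h eulerDl eulerZl hornerD hornerZ.
    by rewrite addrC mulrC.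
  have -> : q.[0] * expi u + q'.[0] = h.[0].
    by rewrite /h hornerD hornerZ addrC mulrC.
  apply: (arestov_roots n0 p0) => // b h0 hb.
  by apply: (@root_mirror_combination _ n s (expi u) b sn _ h0 hb); rewrite cmod_expi.
have iF' u : circle_integrable (fun t => F (t, u)).
  have := cmod_powR_integrable (expi u *: A + B) p0.
  by congr circle_integrable; apply/funext => t; rewrite /F hornerD hornerZ mulrC.
set l := _ *: 'X + _.
have lE u : cmod (q.[0] * expi u + q'.[0]) = cmod l.[expi u] by rewrite /l !hornerE.
have T : (\int[mu]_(t in circle) \int[mu]_(u in circle) (F (t, u))%:E =
    \int[mu]_(u in circle) \int[mu]_(t in circle) (F (t, u))%:E)%E.
  exact: restricted_tonelli measurable_circle measurable_circle mF F0.
have : (\int[mu]_(t in circle) (2 * pi * (K * cmod A.[expi t] `^ p))%:E <=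
    \int[mu]_(u in circle) (2 * pi * (pmean p P * cmod l.[expi u] `^ p))%:E)%E.
  apply: (@le_trans _ _
      (\int[mu]_(t in circle) \int[mu]_(u in circle) (F (t, u))%:E)%E).
    apply: ge0_le_integral; [exact: measurable_circle| | | |].
    - move=> t _; rewrite lee_fin; apply: mulr_ge0; first exact: ltW twopi_gt0.
      by apply: mulr_ge0; [exact: pmean_ge0|exact: powR_ge0].
    - have := circle_integrableZ (2 * pi) (circle_integrableZ K iA).
      by case/integrableP.
    - exact: restricted_tonelli_measurable measurable_circle measurable_circle mF' F0'.
    - move=> t _; rewrite (circle_meanE (iF t)) lee_fin (ler_pM2l twopi_gt0).
      by rewrite mulrC.
  rewrite T; apply: ge0_le_integral; [exact: measurable_circle| | | |].
  - by move=> u _; apply: integral_ge0 => t _; exact: F0.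
  - exact: restricted_tonelli_measurable measurable_circle measurable_circle mF F0.
  - have := circle_integrableZ (2 * pi)
      (circle_integrableZ (pmean p P) (cmod_powR_integrable l p0)).
    by case/integrableP.
  - move=> u _; rewrite (circle_meanE (iF' u)) lee_fin (ler_pM2l twopi_gt0).
    by rewrite mulrC -lE.
have il := cmod_powR_integrable l p0.
rewrite (circle_meanE (circle_integrableZ _ (circle_integrableZ K iA))).
rewrite (circle_meanE (circle_integrableZ _ (circle_integrableZ (pmean p P) il))).
rewrite lee_fin (ler_pM2l twopi_gt0).
rewrite (circle_meanZ _ (circle_integrableZ K iA)) (circle_meanZ _ iA).
rewrite (circle_meanZ _ (circle_integrableZ (pmean p P) il)) (circle_meanZ _ il).
have scalars (x y z w : R) : 2 * pi * (y * x) <= 2 * pi * (w * z) ->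
    x * y <= z * w.
  by rewrite (ler_pM2l twopi_gt0) mulrC [leRHS]mulrC.
exact: scalars.
Qed.

Lemma cmod_roots_at_mirror0 n s :
  cmod (roots_at [seq mirror n a | a <- s]).[0] = cmod (roots_at s).[n%:R].
Proof.
elim: s => [|a s IH] /=; first by rewrite /roots_at !big_nil !hornerC.
rewrite !roots_at_cons !hornerM !hornerXsubC !cmodM IH sub0r cmodN.
by congr (_ * _); rewrite -[RHS]cmodC rmorphB /= conjc_nat.
Qed.

(** Up to a unimodular factor on its constant term, this is the polynomial on
    the right of the two inequalities. *)
Definition endpoint_poly n q : {poly R[i]} := q.[n%:R] *: 'X + q.[0]%:P.

(** [||A||_0 <= ||B||_0], where [B] comes from the mirrored roots; as [B] has no
    zeros in the disc, Jensen's formula gives [||B||_0 = |B(0)|]. *)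
Lemma mahler_euler_le n s P : (0 < n)%N ->
    (forall a, a \in s -> complex.Re a <= n%:R / 2) ->
    (size P <= n.+1)%N -> (forall z, cmod z <= 1 -> P.[z] != 0) ->
  pnorm 0 (euler (roots_at s) P) <=
  pnorm 0 (endpoint_poly n (roots_at s)) * pnorm 0 P.
Proof.
move=> n0 sn sP P0; set q := roots_at s; set q' := roots_at [seq mirror n a | a <- s].
have [A0|A0] := eqVneq (euler q P) 0.
  have -> : pnorm 0 (euler q P) = 0 by rewrite A0 /pnorm eqxx /mahler eqxx.
  by apply: mulr_ge0; exact: pnorm_ge0.
have P0' : zero_free P by move=> y /ltW; exact: P0.
have B0 : zero_free (euler q' P).
  move=> y y1; apply: (@euler_neq0 _ n) => //; first exact: roots_at_neq0.
    move=> b; rewrite root_prod_XsubC => /mapP[a /sn + ->].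
    exact: Re_mirror.
  by move=> x xy; apply: P0; rewrite (le_trans xy)// ltW.
have B00 : euler q' P != 0.
  apply/eqP => B; have := B0 0; rewrite cmod0 ltr01 B horner0 eqxx.
  by move=> /(_ isT).
apply: (@le_trans _ _ (pnorm 0 (euler q' P))).
  rewrite (pnorm0_logabs A0) (pnorm0_logabs B00) ler_expR.
  apply: (le_circle_mean_logabs A0 B00) => z z1.
  by apply: (euler_le_mirror n0 sn sP) => y; rewrite z1; exact: P0.
rewrite (mahler_zero_free B0) (mahler_zero_free P0') euler_at0 cmodM.
apply: ler_wpM2r; first exact: cmod_ge0.
rewrite /q' cmod_roots_at_mirror0; exact: mahler_linear_ge.
Qed.

Lemma pnorm_euler_le n s P p : (0 < n)%N -> 0 <= p ->
    (forall a, a \in s -> complex.Re a <= n%:R / 2) ->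
    (size P <= n.+1)%N -> (forall z, cmod z <= 1 -> P.[z] != 0) ->
  pnorm p (euler (roots_at s) P) <=
  pnorm p (endpoint_poly n (roots_at s)) * (pnorm p P / pnorm p (1 + 'X)).
Proof.
move=> n0 + sn sP P0; rewrite le_eqVlt => /predU1P[<-|p0].
  apply: le_trans (mahler_euler_le n0 sn sP P0) _.
  apply: ler_wpM2l; first exact: pnorm_ge0.
  have E : pnorm 0 P / pnorm 0 (1 + 'X) = pnorm 0 P.
    by rewrite -[RHS]divr1; congr (_ / _); exact: mahler_1X.
  by rewrite E.
have main := pmean_euler_le n0 p0 sn sP P0.
have key (x y z w r : R) : 0 <= x -> 0 <= y -> 0 <= z -> 0 <= w -> 0 <= r ->
    x * y <= z * w -> x `^ r * y `^ r <= z `^ r * w `^ r.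
  move=> x0 y0 z0 w0 r0 le; rewrite -!powRM//.
  by apply: ge0_ler_powR => //; rewrite nnegrE mulr_ge0.
have pl : 0 <= p^-1 by rewrite invr_ge0 ltW.
have {}main : pnorm p (euler (roots_at s) P) * pnorm p (1 + 'X) <= pnorm p
    ((roots_at s).[0] *: 'X + (roots_at [seq mirror n a | a <- s]).[0]%:P) *
    pnorm p P.
  rewrite 4!(pnorm_pmean _ p0).
  exact: (key _ _ _ _ _ (pmean_ge0 _ _) (pmean_ge0 _ _) (pmean_ge0 _ _)
    (pmean_ge0 _ _) pl main).
rewrite mulrA ler_pdivlMr; last by apply: pnorm_1X_gt0; exact: ltW.
suff -> : pnorm p (endpoint_poly n (roots_at s)) =
    pnorm p ((roots_at s).[0] *: 'X + (roots_at [seq mirror n a | a <- s]).[0]%:P).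
  exact: main.
rewrite [RHS]pnorm_linear_swap; apply: (@pnorm_binomial _ p 1) => //.
by rewrite cmod_roots_at_mirror0.
Qed.

Lemma euler_binomial n q a b : (0 < n)%N ->
  euler q (a *: 'X^n + b%:P) = (a * q.[n%:R]) *: 'X^n + (q.[0] * b)%:P.
Proof. by move=> n0; rewrite eulerDr eulerZr euler_Xn euler_const scalerA. Qed.

Lemma scale_linear c a b : c *: (a *: 'X + b%:P) = (c * a) *: 'X + (c * b)%:P.
Proof. by rewrite scalerDr scalerA polyCM mul_polyC. Qed.

Lemma pnorm_euler_binomial n q a b p : (0 < n)%N -> 0 <= p -> cmod a = cmod b ->
  pnorm p (euler q (a *: 'X^n + b%:P)) = cmod a * pnorm p (endpoint_poly n q).
Proof.
move=> n0 p0 ab; transitivity (pnorm p (a *: endpoint_poly n q)); last exact: pnormZ.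
rewrite (euler_binomial _ _ _ n0) scale_linear; apply: pnorm_binomial => //.
by rewrite !cmodM ab mulrC.
Qed.

Lemma pnorm_binomial_1X n a b p : (0 < n)%N -> 0 <= p -> cmod a = cmod b ->
  pnorm p (a *: 'X^n + b%:P) = cmod a * pnorm p (1 + 'X).
Proof.
move=> n0 p0 ab; transitivity (pnorm p (a *: (1 *: 'X + 1%:P))).
  by rewrite scale_linear; apply: pnorm_binomial; rewrite // mulr1.
by rewrite (pnormZ _ _ p0) scale1r polyC1 addrC.
Qed.

(** Lowering the coefficient of [X] is an admissible operator on polynomials of
    degree at most [1], as it amounts to a dilation. *)
Lemma pnorm_linear_contract (r : R) a b p : 0 <= p -> 0 <= r <= 1 -> b != 0 ->
  pnorm p ((r%:C%C * a) *: 'X + b%:P) <= pnorm p (a *: 'X + b%:P).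
Proof.
move=> p0 /andP[r0 r1] b0; pose h : {poly R[i]} := 1 + (r%:C%C - 1) *: 'X.
have h0 : h.[0] = 1 by rewrite /h !hornerE.
have h1 : h.[1] = r%:C%C.
  by rewrite /h hornerD hornerZ hornerX mulr1 -polyC1 hornerC addrC subrK.
have hE g : (size g <= 2)%N -> forall y, (euler h g).[y] = g.[r%:C%C * y].
  move=> sg y; rewrite (horner_coef_wide _ (leq_trans (size_euler _ _) sg)).
  rewrite (horner_coef_wide _ sg) !big_ord_recl !big_ord0 /= !coef_euler.
  by rewrite h0 h1 /bump /= !expr0 !expr1; ring.
have had : admissible 1 h.
  move=> g sg g0 y y1; rewrite hE//; apply: g0.
  rewrite cmodM cmod_real ger0_norm// (le_lt_trans _ y1)//.
  by rewrite ler_piMl ?cmod_ge0.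
pose f := a *: 'X + b%:P.
have sf : (size f <= 2)%N.
  rewrite (leq_trans (size_polyD _ _))// geq_max (leq_trans (size_polyC_leq1 _))//.
  by rewrite andbT (leq_trans (size_scale_leq _ _))// size_polyX.
have <- : euler h f = (r%:C%C * a) *: 'X + b%:P.
  rewrite /f -['X]expr1 euler_binomial// h1 h0 mul1r.
  by rewrite [a * _]mulrC.
have f0 : f.[0] != 0 by rewrite /f !hornerE.
have fz : f != 0 by apply/eqP => fE; move: f0; rewrite fE horner0 eqxx.
have hfz : euler h f != 0.
  apply/eqP => hf; move: f0; rewrite -[f.[0]]mul1r -h0 -euler_at0 hf.
  by rewrite horner0 eqxx.
move: p0; rewrite le_eqVlt => /predU1P[<-|p0].
  rewrite (pnorm0_logabs fz) (pnorm0_logabs hfz) ler_expR.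
  exact: (arestov_log had h0 sf f0).
rewrite 2!(pnorm_pmean _ p0); apply: ge0_ler_powR.
- by rewrite invr_ge0 ltW.
- by rewrite nnegrE; exact: pmean_ge0.
- by rewrite nnegrE; exact: pmean_ge0.
have h00 : h.[0] != 0 by rewrite h0 oner_neq0.
by have := arestov p0 had h00 sf; rewrite h0 cmod1 powR1 mul1r.
Qed.

(** For [P = X^n + r] and [r > 1], [pnorm_linear_contract] bounds
    [||euler q P||_p] from below by its value at [r = 1] and [||P||_p] from
    above by [r ||1 + X||_p]; then [r] tends to [1]. *)
Lemma not_improvable_euler n q p : (0 < n)%N -> 0 <= p -> q.[n%:R] != 0 ->
  not_improvable n p (euler q) (pnorm p (endpoint_poly n q) / pnorm p (1 + 'X)).
Proof.
move=> n0 p0 qn c' H; have N0 := pnorm_1X_gt0 p0.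
set N := pnorm p (1 + 'X) in N0 *; set L := pnorm p (endpoint_poly n q).
have alg (x y M d e : R) : 0 < M -> 0 <= d -> y <= e * M -> x <= d * y ->
    x / M <= d * e.
  by move=> M0 d0 ye xy; rewrite ler_pdivrMr// -mulrA (le_trans xy)// ler_wpM2l.
have key (r : R) : 1 < r -> L / N <= c' * r.
  move=> r1; have r0 : 0 < r by rewrite (lt_trans ltr01).
  pose P : {poly R[i]} := 1 *: 'X^n + (r%:C%C)%:P.
  have cP : nonvanishing_of_degree n P.
    split.
      rewrite /P scale1r size_polyDl ?size_polyXn//.
      by rewrite (leq_ltn_trans (size_polyC_leq1 _)).
    move=> z z1; rewrite /P !hornerE addr_eq0; apply/eqP.
    move=> /(congr1 (@cmod R)); rewrite cmodN cmod_real (gtr0_norm r0) cmodX => zr.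
    by move: r1; rewrite -zr ltNge exprn_ile1 ?cmod_ge0.
  have := H P cP.
  have rc : 0 <= r^-1 <= 1 by rewrite invr_ge0 (ltW r0) invf_le1 ?(ltW r1).
  have rr : r^-1%:C%C * r%:C%C = 1 :> R[i].
    by rewrite -rmorphM mulVf ?rmorph1// gt_eqF.
  have -> : pnorm p (euler q P) = pnorm p ((r%:C%C * q.[0]) *: 'X + q.[n%:R]%:P).
    rewrite [RHS]pnorm_linear_swap (euler_binomial _ _ _ n0).
    by apply: pnorm_binomial => //; rewrite ?mul1r// mulrC.
  have low : L <= pnorm p ((r%:C%C * q.[0]) *: 'X + q.[n%:R]%:P).
    have -> : L = pnorm p ((r^-1%:C%C * (r%:C%C * q.[0])) *: 'X + q.[n%:R]%:P).
      by rewrite mulrA rr mul1r; exact: pnorm_linear_swap.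
    exact: pnorm_linear_contract.
  have NE : N = pnorm p (1 *: 'X + 1%:P : {poly R[i]}).
    by rewrite /N scale1r polyC1 addrC.
  have PE : pnorm p P = pnorm p (r%:C%C *: 'X + 1%:P).
    by rewrite [RHS]pnorm_linear_swap; exact: pnorm_binomial.
  have up : pnorm p P <= r * N.
    have le1 : pnorm p ((r^-1%:C%C * 1) *: 'X + 1%:P) <= N.
      by rewrite NE; apply: pnorm_linear_contract => //; exact: oner_neq0.
    have -> : pnorm p P = r * pnorm p ((r^-1%:C%C * 1) *: 'X + 1%:P).
      transitivity (pnorm p (r%:C%C *: ((r^-1%:C%C * 1) *: 'X + 1%:P))).
        rewrite scale_linear mulr1 [_ * r^-1%:C%C]mulrC rr.
        by apply: pnorm_binomial; [exact: n0|by []|rewrite mulr1].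
      by rewrite (pnormZ _ _ p0) cmod_real gtr0_norm.
    by rewrite (ler_pM2l r0).
  have P0 : N <= pnorm p P.
    have -> : N = pnorm p ((r^-1%:C%C * r%:C%C) *: 'X + 1%:P).
      by rewrite rr; exact: NE.
    rewrite PE; apply: pnorm_linear_contract => //; exact: oner_neq0.
  move=> /(le_trans low) le.
  have c0 : 0 <= c'.
    have PP : 0 < pnorm p P := lt_le_trans N0 P0.
    by rewrite -(pmulr_lge0 _ PP); exact: le_trans (pnorm_ge0 _ _) le.
  exact: (alg _ _ _ _ _ N0 c0 up le).
have LN : 0 <= L / N by apply: divr_ge0; [exact: pnorm_ge0|exact: ltW].
have c0 : 0 <= c'.
  have r2 : 1 < 2 :> R by rewrite ltr1n.
  have r0 : 0 < 2 :> R by [].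
  by rewrite -(pmulr_lge0 _ r0); exact: le_trans LN (key 2 r2).
apply/ler_addgt0Pr => e e0.
have c1 : 0 < c' + 1 by lra.
(* [c' / (c' + 1) <= 1] makes the error at most [e]. *)
apply: (le_trans (key (1 + e / (c' + 1)) _)).
  by rewrite ltrDl divr_gt0.
rewrite mulrDr mulr1 lerD2l mulrCA ler_piMr ?(ltW e0)//.
by rewrite ler_pdivrMr// mul1r lerDl.
Qed.

End Main.

(** * The two operators of the theorem *)

Section Specialization.
Context {R : realType}.
Implicit Types (f : {poly R[i]}) (a b : R[i]).

Lemma op1_roots a : op1 a = euler (roots_at [:: a]).
Proof. by apply/funext => f; rewrite op1E /roots_at big_seq1. Qed.

Lemma op2_roots a b : op2 a b = euler (roots_at [:: a; b]).
Proof. by apply/funext => f; rewrite op2E !roots_at_cons /roots_at big_nil mulr1. Qed.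

Lemma pnorm_lin1 p n a : pnorm p (lin1 n a) = pnorm p (endpoint_poly n (roots_at [:: a])).
Proof.
rewrite /lin1 /endpoint_poly /roots_at big_seq1 !hornerXsubC sub0r.
by apply/esym/(@pnorm_binomial _ p 1); rewrite // cmodN.
Qed.

Lemma lin2E n a b : lin2 n a b = endpoint_poly n (roots_at [:: a; b]).
Proof.
rewrite /lin2 /endpoint_poly !roots_at_cons /roots_at big_nil mulr1.
rewrite !hornerM !hornerXsubC; congr (_ *: _ + _%:P); by ring.
Qed.

Lemma roots_at_n_neq0 n (s : seq R[i]) : (0 < n)%N ->
  (forall a, a \in s -> complex.Re a <= n%:R / 2) -> (roots_at s).[n%:R] != 0.
Proof.
move=> n0 sn; rewrite -rootE root_prod_XsubC; apply/negP => /sn.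
rewrite cRe_nat; have : 0 < n%:R :> R by rewrite ltr0n.
by lra.
Qed.

End Specialization.

Theorem theorem2 (R : realType) (n : nat) (alpha gamma : R[i]) (p : R)
    (n_gt0 : (0 < n)%N)
    (alpha_le : complex.Re alpha <= n%:R / 2)
    (gamma_le : complex.Re gamma <= n%:R / 2)
    (p_ge0 : 0 <= p) :
  [/\ (forall P : {poly R[i]}, nonvanishing_of_degree n P ->
         pnorm p (op1 alpha P) <=
           pnorm p (lin1 n alpha) * (pnorm p P / pnorm p (1 + 'X)) /\
         pnorm p (op2 alpha gamma P) <=
           pnorm p (lin2 n alpha gamma) * (pnorm p P / pnorm p (1 + 'X))),
      not_improvable n p (op1 alpha)
        (pnorm p (lin1 n alpha) / pnorm p (1 + 'X)),
      not_improvable n p (op2 alpha gamma)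
        (pnorm p (lin2 n alpha gamma) / pnorm p (1 + 'X))
    & (forall (a b : R[i]) (P : {poly R[i]}),
         cmod a = cmod b -> cmod b != 0 -> P = a *: 'X^n + b%:P ->
         pnorm p (op1 alpha P) =
           pnorm p (lin1 n alpha) * (pnorm p P / pnorm p (1 + 'X)) /\
         pnorm p (op2 alpha gamma P) =
           pnorm p (lin2 n alpha gamma) * (pnorm p P / pnorm p (1 + 'X)))].
Proof.
have s1 a : a \in [:: alpha] -> complex.Re a <= n%:R / 2.
  by rewrite inE => /eqP ->.
have s2 a : a \in [:: alpha; gamma] -> complex.Re a <= n%:R / 2.
  by rewrite !inE => /orP[] /eqP ->.
rewrite pnorm_lin1 lin2E op1_roots op2_roots; split.
- move=> P [sP P0].
  have sP' : (size P <= n.+1)%N by rewrite sP.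
  by split; [exact: (pnorm_euler_le n_gt0 p_ge0 s1 sP' P0)|
             exact: (pnorm_euler_le n_gt0 p_ge0 s2 sP' P0)].
- exact: (not_improvable_euler n_gt0 p_ge0 (roots_at_n_neq0 n_gt0 s1)).
- exact: (not_improvable_euler n_gt0 p_ge0 (roots_at_n_neq0 n_gt0 s2)).
- move=> a b P ab _ ->.
  have N0 := pnorm_1X_gt0 (R := R) p_ge0.
  rewrite (pnorm_binomial_1X n_gt0 p_ge0 ab) mulfK ?gt_eqF//.
  have eqn q : pnorm p (euler q (a *: 'X^n + b%:P)) =
      pnorm p (endpoint_poly n q) * cmod a.
    by rewrite [RHS]mulrC; exact: pnorm_euler_binomial.
  by split; exact: eqn.
Qed.
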